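(* Let $X$ be a Banach space with property (R). Then each of the following holds: (1) A bounded subset of $X$ contains $\ell_1^N$ bases uniformly if and only if it contains a sequence equivalent to the canonical basis of $\ell_1$. (2) Any (closed) subspace of $X$ with nontrivial type is superreflexive.
   Context: Weakly precompact sets: A bounded subset $A$ of a Banach space is weakly precompact if it does not contain a sequence equivalent to the canonical basis of $\ell_1$. Relatively super weakly compact sets: For a Banach space $Y$ and a free ultrafilter $\mathcal{U}$ on $\mathbb{N}$, $Y^{\mathcal{U}}$ is the quotient of $\ell_\infty(Y)$ by $\{(y_n)_n\in\ell_\infty(Y):\lim_{\mathcal{U}}\|y_n\|=0\}$. For $A\subseteq Y$, $A^{\mathcal{U}}\subseteq Y^{\mathcal{U}}$ is the set of elements having a representative $(y_n)_n$ with $y_n\in A$ for every $n$. The set $A$ is relatively super weakly compact if $A^{\mathcal{U}}$ is relatively weakly compact in $Y^{\mathcal{U}}$ for every free ultrafilter $\mathcal{U}$ on $\mathbb{N}$. Property (R): A Banach space has property (R) if every weakly precompact set in it is relatively super weakly compact. Containing $\ell_1^N$ bases uniformly: A subset $A$ of a Banach space contains $\ell_1^N$ bases uniformly if there is $C>0$ such that for every $N\in\mathbb{N}$ the set $A$ contains a $C$-equivalent copy of the canonical basis of $\ell_1^N$, i.e. there are $x_1,\dots,x_N\in A$ with $C^{-1}\sum_{i=1}^N|a_i|\le\|\sum_{i=1}^N a_ix_i\|\le C\sum_{i=1}^N|a_i|$ for all scalars $a_1,\dots,a_N$. Nontrivial type means (Rademacher) type $p$ for some $p>1$. *)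

(* Defs.v *)
From HB Require Import structures.
From mathcomp Require Import all_boot all_order all_algebra.
From mathcomp Require Import all_classical all_reals all_analysis.
From mathcomp Require Import complex.

Set Implicit Arguments.
Unset Strict Implicit.
Unset Printing Implicit Defensive.

Import Order.TTheory GRing.Theory Num.Theory.
Import numFieldNormedType.Exports.
Local Open Scope classical_set_scope.
Local Open Scope ring_scope.

(* Banach spaces are real or complex: [scalars R k] is [R] or [R[i]].  A norm
   takes its values in the scalar field, as always in MathComp-Analysis;
   [rnorm] is the same norm, read as an element of [R]. *)
Variant scalar_kind := RealScalars | ComplexScalars.

Definition scalars (R : realType) (k : scalar_kind) : numFieldType :=
  match k with
  | RealScalars => R
  | ComplexScalars => R[i]
  end.

Definition scalar_re (R : realType) (k : scalar_kind) : scalars R k -> R :=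
  match k with
  | RealScalars => id
  | ComplexScalars => @complex.Re R
  end.

Definition of_real (R : realType) (k : scalar_kind) : R -> scalars R k :=
  match k with
  | RealScalars => id
  | ComplexScalars => fun x => x%:C%C
  end.
Arguments of_real {R k} x.

Definition rnorm (R : realType) (k : scalar_kind)
  (V : normedModType (scalars R k)) (x : V) : R := scalar_re `|x|.

Section rnorm_theory.
Variables (R : realType) (k : scalar_kind).
Local Notation K := (scalars R k).

Lemma of_realD : {morph @of_real R k : x y / x + y}.
Proof. by case: k => //= x y; rewrite rmorphD. Qed.

Lemma of_realM : {morph @of_real R k : x y / x * y}.
Proof. by case: k => //= x y; rewrite rmorphM. Qed.

Lemma of_real0 : of_real 0 = 0 :> K.
Proof. by case: k. Qed.

Lemma of_realK : cancel (@of_real R k) (@scalar_re R k).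
Proof. by case: k. Qed.

Lemma ler_of_real (x y : R) : (of_real x <= of_real y :> K) = (x <= y).
Proof. by case: k => //=; rewrite lecR. Qed.

Lemma of_real_scalar_re (a : K) : 0 <= a -> of_real (scalar_re a) = a.
Proof.
by move: a; case: k => //= -[x y]; rewrite lecE /= => /andP[/eqP-> _].
Qed.

Variable V : normedModType K.
Implicit Types x y : V.

Lemma of_real_rnorm x : of_real (rnorm x) = `|x|.
Proof. by rewrite of_real_scalar_re. Qed.

Lemma rnorm_ge0 x : 0 <= rnorm x.
Proof. by rewrite -ler_of_real of_real_rnorm of_real0. Qed.

Lemma rnorm0 : rnorm (0 : V) = 0.
Proof. by rewrite /rnorm normr0 -of_real0 of_realK. Qed.

Lemma rnorm0_eq0 x : rnorm x = 0 -> x = 0.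
Proof. by move=> x0; apply/eqP; rewrite -normr_eq0 -of_real_rnorm x0 of_real0. Qed.

Lemma ler_rnormD x y : rnorm (x + y) <= rnorm x + rnorm y.
Proof. by rewrite -ler_of_real of_realD !of_real_rnorm ler_normD. Qed.

Lemma rnormZ (a : K) x : rnorm (a *: x) = scalar_re `|a| * rnorm x.
Proof.
rewrite -[LHS]of_realK -[RHS]of_realK; congr scalar_re.
by rewrite of_realM !of_real_rnorm of_real_scalar_re ?normrZ.
Qed.

Lemma scalar_re_norm_ge0 (a : K) : 0 <= scalar_re `|a|.
Proof. by rewrite -ler_of_real of_real_scalar_re ?of_real0. Qed.

End rnorm_theory.

Section subspace.
Variables (R : realType) (k : scalar_kind).
Local Notation K := (scalars R k).
Variables (V : normedModType K) (S : submodClosed V).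

Definition subspace_of := {x : V | x \in S}.

HB.instance Definition _ := SubType.on subspace_of.
HB.instance Definition _ := Choice.on subspace_of.
HB.instance Definition _ := GRing.SubChoice_isSubLmodule.Build
  K V _ subspace_of (GRing.subsemimodClosedP S).

Definition sub_norm (x : subspace_of) : K := `|val x|.

Let sub_normD x y : sub_norm (x + y) <= sub_norm x + sub_norm y.
Proof. by rewrite /sub_norm raddfD ler_normD. Qed.

Let sub_normZ a x : sub_norm (a *: x) = `|a| * sub_norm x.
Proof. by rewrite /sub_norm linearZ normrZ. Qed.

Let sub_norm0_eq0 x : sub_norm x = 0 -> x = 0.
Proof.
by move=> /eqP; rewrite normr_eq0 => /eqP x0; apply: val_inj; rewrite x0 raddf0.
Qed.

HB.instance Definition _ :=
  Lmodule_isNormed.Build K subspace_of sub_normD sub_normZ sub_norm0_eq0.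

End subspace.

(* The sup norm of [f] over [A]; the norms of [linfty] and [dual] are
   instances of it. *)
Section sup_norm.
Variables (R : realType) (k : scalar_kind).
Local Notation K := (scalars R k).
Variables (T : Type) (V : normedModType K) (A : set T).
Implicit Types f g : T -> V.

Definition sup_norm f : R := sup [set rnorm (f x) | x in A].

Definition bounded_on f := exists M, forall x, A x -> rnorm (f x) <= M.

Lemma bounded_on0 : bounded_on (0 : T -> V).
Proof. by exists 0 => x _; rewrite rnorm0. Qed.

Lemma bounded_onD f g : bounded_on f -> bounded_on g -> bounded_on (f + g).
Proof.
move=> [M fM] [N gN]; exists (M + N) => x Ax.
by rewrite (le_trans (ler_rnormD _ _))// lerD// ?fM ?gN.
Qed.

Lemma bounded_onZ (a : K) f : bounded_on f -> bounded_on (a *: f).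
Proof.
move=> [M fM]; exists (scalar_re `|a| * M) => x Ax.
by rewrite rnormZ ler_wpM2l ?scalar_re_norm_ge0// fM.
Qed.

Hypothesis A0 : A !=set0.

Let im0 f : [set rnorm (f x) | x in A] !=set0.
Proof. by have [x Ax] := A0; exists (rnorm (f x)); exists x. Qed.

Lemma sup_norm_ub f x : bounded_on f -> A x -> rnorm (f x) <= sup_norm f.
Proof.
move=> [M fM] Ax; apply: ub_le_sup; last by exists x.
by exists M => _ [y Ay <-]; exact: fM.
Qed.

Lemma sup_norm_le f M : (forall x, A x -> rnorm (f x) <= M) -> sup_norm f <= M.
Proof. by move=> fM; apply: ge_sup => // _ [x Ax <-]; exact: fM. Qed.

Lemma sup_norm_ge0 f : bounded_on f -> 0 <= sup_norm f.
Proof.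
by have [x Ax] := A0 => bf; rewrite (le_trans (rnorm_ge0 (f x)))// sup_norm_ub.
Qed.

Lemma sup_normD f g : bounded_on f -> bounded_on g ->
  sup_norm (f + g) <= sup_norm f + sup_norm g.
Proof.
move=> bf bg; apply: sup_norm_le => x Ax.
by rewrite (le_trans (ler_rnormD _ _))// lerD// sup_norm_ub.
Qed.

Let sup_normZ_le (a : K) f : bounded_on f ->
  sup_norm (a *: f) <= scalar_re `|a| * sup_norm f.
Proof.
move=> bf; apply: sup_norm_le => x Ax.
by rewrite rnormZ ler_wpM2l ?scalar_re_norm_ge0// sup_norm_ub.
Qed.

Lemma sup_normZ (a : K) f : bounded_on f ->
  sup_norm (a *: f) = scalar_re `|a| * sup_norm f.
Proof.
move=> bf; apply/eqP; rewrite eq_le sup_normZ_le//=.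
have [->|a0] := eqVneq a 0.
  rewrite normr0 -(of_real0 R k) of_realK mul0r sup_norm_ge0//.
  exact: bounded_onZ.
have := sup_normZ_le a^-1 (bounded_onZ a bf).
rewrite scalerA mulVf// scale1r => le.
rewrite (le_trans (ler_wpM2l (scalar_re_norm_ge0 a) le))// mulrA.
rewrite -[X in X * _](of_realK k) of_realM !of_real_scalar_re//.
have e1 : scalar_re (1 : K) = 1 by clear; case: k.
by rewrite -normrM mulfV// normr1 e1 mul1r.
Qed.

End sup_norm.

Section linfty.
Variables (R : realType) (k : scalar_kind).
Local Notation K := (scalars R k).
Variable Y : normedModType K.

Definition linfty_pred : {pred (nat -> Y)} :=
  fun u => `[< bounded_on setT u >].

Let linfty_submod : submod_closed linfty_pred.
Proof.
split=> [|a u v]; first by apply/asboolP; exact: bounded_on0.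
by move=> /asboolP bu /asboolP bv; apply/asboolP/bounded_onD => //; exact: bounded_onZ.
Qed.

HB.instance Definition _ :=
  GRing.isSubmodClosed.Build K (nat -> Y) linfty_pred linfty_submod.

Definition linfty := {u : nat -> Y | u \in linfty_pred}.

HB.instance Definition _ := SubType.on linfty.
HB.instance Definition _ := Choice.on linfty.
HB.instance Definition _ := GRing.SubChoice_isSubLmodule.Build
  K (nat -> Y) _ linfty (GRing.subsemimodClosedP linfty_pred).

Lemma linftyP (u : linfty) : bounded_on setT (val u).
Proof. by have /asboolP := valP u. Qed.

Let T0 : [set: nat] !=set0. Proof. by exists 0%N. Qed.

Definition linfty_norm (u : linfty) : K := of_real (sup_norm setT (val u)).

Let linfty_normD u v : linfty_norm (u + v) <= linfty_norm u + linfty_norm v.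
Proof.
rewrite /linfty_norm -of_realD ler_of_real raddfD.
by apply: sup_normD => //; exact: linftyP.
Qed.

Let linfty_normZ a u : linfty_norm (a *: u) = `|a| * linfty_norm u.
Proof.
rewrite /linfty_norm linearZ sup_normZ//; last exact: linftyP.
by rewrite of_realM of_real_scalar_re.
Qed.

Let linfty_norm0_eq0 u : linfty_norm u = 0 -> u = 0.
Proof.
move=> /(congr1 (@scalar_re R k)); rewrite of_realK -(of_real0 R k) of_realK => u0.
apply: val_inj; rewrite raddf0; apply/funext => n; apply: rnorm0_eq0.
apply/eqP; rewrite eq_le rnorm_ge0 andbT -u0 sup_norm_ub//.
exact: linftyP.
Qed.

HB.instance Definition _ :=
  Lmodule_isNormed.Build K linfty linfty_normD linfty_normZ linfty_norm0_eq0.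

Lemma rnorm_linfty (u : linfty) : rnorm u = sup_norm setT (val u).
Proof. by rewrite /rnorm /Num.norm/= of_realK. Qed.

End linfty.

Record free_ultrafilter := FreeUltrafilter {
  fu_sets :> set_system nat ;
  fu_ultra : UltraFilter fu_sets ;
  fu_free : \bigcap_(A in fu_sets) A = set0
}.

#[global] Instance free_ultrafilter_proper (U : free_ultrafilter) :
  ProperFilter (fu_sets U).
Proof. by case: U => F []. Qed.

Section ultrapower.
Variables (R : realType) (k : scalar_kind).
Local Notation K := (scalars R k).
Variables (Y : normedModType K) (U : free_ultrafilter).

Definition ultra_null : {pred linfty Y} :=
  fun u => `[< rnorm (val u n) @[n --> fu_sets U] --> (0 : R) >].

Let ultra_nullP (u : linfty Y) :
  reflect (forall e : R, 0 < e -> \forall n \near fu_sets U, rnorm (val u n) <= e)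
          (u \in ultra_null).
Proof.
apply: (iffP (asboolP _)) => [u0 e e0|u0].
  have /cvgrPdist_le /(_ _ e0) := u0; apply: filterS => n /=.
  by rewrite sub0r normrN ger0_norm// rnorm_ge0.
apply/cvgrPdist_le => e /u0; apply: filterS => n /=.
by rewrite sub0r normrN ger0_norm// rnorm_ge0.
Qed.

Let ultra_null_submod : submod_closed ultra_null.
Proof.
split=> [|a u v /ultra_nullP u0 /ultra_nullP v0].
  by apply/ultra_nullP => e e0; apply: nearW => n; rewrite rnorm0 ltW.
apply/ultra_nullP => e e0.
have a0 : 0 < scalar_re `|a| + 1.
  by rewrite (lt_le_trans ltr01)// lerDr scalar_re_norm_ge0.
have ea : 0 < e / 2 / (scalar_re `|a| + 1) by rewrite !divr_gt0.
have e2 : 0 < e / 2 by rewrite divr_gt0.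
apply: filterS2 (u0 _ ea) (v0 _ e2) => n un vn.
rewrite [leRHS]splitr (le_trans (ler_rnormD _ _))// lerD// rnormZ.
have := ler_pM (rnorm_ge0 _) (scalar_re_norm_ge0 a) un (lexx _).
rewrite mulrC => /le_trans; apply.
by rewrite mulrAC ler_pdivrMr// ler_wpM2l ?lerDl// ltW.
Qed.

HB.instance Definition _ :=
  GRing.isSubmodClosed.Build K (linfty Y) ultra_null ultra_null_submod.

Definition ultrapower := Quotient.quot ultra_null.

HB.instance Definition _ := EqQuotient.on ultrapower.
HB.instance Definition _ := Choice.on ultrapower.
HB.instance Definition _ := GRing.Zmodule.on ultrapower.

Definition ultra_class (u : linfty Y) : ultrapower := (\pi u)%qT.

Lemma ultra_class_eq u v : (ultra_class u = ultra_class v) <-> u - v \in ultra_null.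
Proof.
rewrite /ultra_class; split=> [/eqP|uv]; first by rewrite -Quotient.idealrBE.
by apply/eqP; rewrite -Quotient.idealrBE.
Qed.

Lemma ultra_class_surj q : exists u, q = ultra_class u.
Proof. by exists (repr q); rewrite /ultra_class reprK. Qed.

Lemma ultra_classD u v : ultra_class (u + v) = ultra_class u + ultra_class v.
Proof. by rewrite /ultra_class !piE. Qed.

Lemma ultra_class0 : ultra_class 0 = 0.
Proof. by rewrite /ultra_class !piE. Qed.

Definition ultra_scale (a : K) (q : ultrapower) : ultrapower :=
  ultra_class (a *: repr q).

Lemma ultra_classZ a u : ultra_class (a *: u) = ultra_scale a (ultra_class u).
Proof.
apply/ultra_class_eq; rewrite -scalerBr rpredZ//.
by apply/ultra_class_eq; rewrite {2}/ultra_class reprK.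
Qed.

Let scaleA a b q : ultra_scale a (ultra_scale b q) = ultra_scale (a * b) q.
Proof.
by have [u ->] := ultra_class_surj q; rewrite -!ultra_classZ scalerA.
Qed.

Let scale1 : left_id 1 ultra_scale.
Proof. by move=> q; have [u ->] := ultra_class_surj q; rewrite -ultra_classZ scale1r. Qed.

Let scaleDr : right_distributive ultra_scale +%R.
Proof.
move=> a q r; have [u ->] := ultra_class_surj q.
have [v ->] := ultra_class_surj r.
by rewrite -ultra_classD -!ultra_classZ scalerDr ultra_classD.
Qed.

Let scaleDl q : {morph ultra_scale^~ q : a b / a + b}.
Proof.
move=> a b; have [u ->] := ultra_class_surj q.
by rewrite -!ultra_classZ scalerDl ultra_classD.
Qed.

HB.instance Definition _ := GRing.Zmodule_isLmodule.Build K ultrapower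
  scaleA scale1 scaleDr scaleDl.

(* The quotient norm: infimum of the norms of the representatives. *)
Definition ultra_rnorm (q : ultrapower) : R :=
  inf [set rnorm u | u in [set u : linfty Y | ultra_class u = q]].

Let ultra_lb (q : ultrapower) :
  has_lbound [set rnorm u | u in [set u : linfty Y | ultra_class u = q]].
Proof. by exists 0 => _ [u _ <-]; exact: rnorm_ge0. Qed.

Let ultra_ne (q : ultrapower) :
  [set rnorm u | u in [set u : linfty Y | ultra_class u = q]] !=set0.
Proof. by have [u ->] := ultra_class_surj q; exists (rnorm u); exists u. Qed.

Lemma ultra_rnorm_le u : ultra_rnorm (ultra_class u) <= rnorm u.
Proof. by apply: ge_inf => //; exists u. Qed.

Lemma ultra_rnorm_ge0 q : 0 <= ultra_rnorm q.
Proof. by apply: lb_le_inf => // _ [u _ <-]; exact: rnorm_ge0. Qed.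

Lemma ultra_rnorm_lt q e : ultra_rnorm q < e ->
  exists2 u, ultra_class u = q & rnorm u < e.
Proof.
by move=> qe; have [_ [u uq <-] ue] := inf_lt (ultra_ne q) qe; exists u.
Qed.

Let ultra_rnormD q r : ultra_rnorm (q + r) <= ultra_rnorm q + ultra_rnorm r.
Proof.
apply/ler_addgt0Pl => e e0.
have e2 : 0 < e / 2 by rewrite divr_gt0.
have [|u <- ulte] := @ultra_rnorm_lt q (ultra_rnorm q + e / 2); first by rewrite ltrDl.
have [|v <- vlte] := @ultra_rnorm_lt r (ultra_rnorm r + e / 2); first by rewrite ltrDl.
rewrite -ultra_classD (le_trans (ultra_rnorm_le _))//.
rewrite (le_trans (ler_rnormD _ _))//.
rewrite [leRHS]addrC [X in _ <= _ + X]splitr addrACA; apply: lerD; apply: ltW.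
  by apply: (lt_le_trans ulte); rewrite lerD2r; exact: lexx.
by apply: (lt_le_trans vlte); rewrite lerD2r; exact: lexx.
Qed.

Let ultra_rnormZ_le a q : ultra_rnorm (a *: q) <= scalar_re `|a| * ultra_rnorm q.
Proof.
have a0 : 0 < scalar_re `|a| + 1.
  by rewrite (lt_le_trans ltr01)// lerDr scalar_re_norm_ge0.
apply/ler_addgt0Pl => e e0.
have ea : 0 < e / (scalar_re `|a| + 1) by rewrite divr_gt0.
have [|u uq ulte] := @ultra_rnorm_lt q (ultra_rnorm q + e / (scalar_re `|a| + 1)).
  by rewrite ltrDl.
rewrite -{1}uq -[a *: _]ultra_classZ (le_trans (ultra_rnorm_le _))// rnormZ.
rewrite (le_trans (ler_wpM2l (scalar_re_norm_ge0 a) (ltW ulte)))//.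
rewrite mulrDr addrC lerD2r mulrCA ler_piMr ?(ltW e0)//.
by rewrite ler_pdivrMr// mul1r lerDl.
Qed.

Let ultra_rnormZ a q : ultra_rnorm (a *: q) = scalar_re `|a| * ultra_rnorm q.
Proof.
apply/eqP; rewrite eq_le ultra_rnormZ_le/=.
have [->|a0] := eqVneq a 0.
  by rewrite normr0 -(of_real0 R k) of_realK mul0r ultra_rnorm_ge0.
have := ultra_rnormZ_le a^-1 (a *: q).
rewrite scalerA mulVf// scale1r => le.
rewrite (le_trans (ler_wpM2l (scalar_re_norm_ge0 a) le))// mulrA.
rewrite -[X in X * _](of_realK k) of_realM !of_real_scalar_re//.
have e1 : scalar_re (1 : K) = 1 by clear; case: k.
by rewrite -normrM mulfV// normr1 e1 mul1r.
Qed.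

Let ultra_rnorm0_eq0 q : ultra_rnorm q = 0 -> q = 0.
Proof.
have [v ->] := ultra_class_surj q => q0.
rewrite -ultra_class0; apply/ultra_class_eq; rewrite subr0.
apply/ultra_nullP => e e0.
have [|u /ultra_class_eq /ultra_nullP uv ulte] := @ultra_rnorm_lt (ultra_class v) (e / 2).
  by rewrite q0 divr_gt0.
have e2 : 0 < e / 2 by rewrite divr_gt0.
apply: filterS (uv _ e2) => n.
rewrite raddfB => uvn.
have -> : val v n = val u n - (val u n - val v n) by rewrite subKr.
rewrite [leRHS]splitr -scaleN1r (le_trans (ler_rnormD _ _))// lerD//.
  rewrite ltW// (le_lt_trans _ ulte)// rnorm_linfty.
  by apply: sup_norm_ub => //; exact: linftyP.
by rewrite rnormZ normrN1 (_ : scalar_re 1 = 1) ?mul1r//; clear; case: k.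
Qed.

Definition ultra_norm (q : ultrapower) : K := of_real (ultra_rnorm q).

Let ultra_normD q r : ultra_norm (q + r) <= ultra_norm q + ultra_norm r.
Proof. by rewrite /ultra_norm -of_realD ler_of_real ultra_rnormD. Qed.

Let ultra_normZ a q : ultra_norm (a *: q) = `|a| * ultra_norm q.
Proof. by rewrite /ultra_norm ultra_rnormZ of_realM of_real_scalar_re. Qed.

Let ultra_norm0_eq0 q : ultra_norm q = 0 -> q = 0.
Proof.
move=> /(congr1 (@scalar_re R k)); rewrite of_realK -(of_real0 R k) of_realK.
exact: ultra_rnorm0_eq0.
Qed.

HB.instance Definition _ :=
  Lmodule_isNormed.Build K ultrapower ultra_normD ultra_normZ ultra_norm0_eq0.

Definition ultra_set (A : set Y) : set ultrapower :=
  [set q | exists2 u : linfty Y, (forall n, A (val u n)) & ultra_class u = q].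

End ultrapower.

Section dual.
Variables (R : realType) (k : scalar_kind).
Local Notation K := (scalars R k).
Variable V : normedModType K.

Definition dual_pred : {pred (V -> K^o)} :=
  fun f => `[< linear f /\ continuous f >].

Let dual_submod : submod_closed dual_pred.
Proof.
split=> [|a f g /asboolP[lf cf] /asboolP[lg cg]]; apply/asboolP; split.
- by move=> b x y; rewrite scaler0 addr0.
- by move=> x; exact: cvg_cst.
- move=> b x y.
  rewrite -![(a *: f + g) _]/(a *: f _ + g _) lf lg !scalerDr !scalerA.
  by rewrite (mulrC a) addrACA.
- by move=> x; apply: cvgD; [apply: cvgZr; exact: cf|exact: cg].
Qed.

HB.instance Definition _ :=
  GRing.isSubmodClosed.Build K (V -> K^o) dual_pred dual_submod.

Definition dual := {f : V -> K^o | f \in dual_pred}.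

HB.instance Definition _ := SubType.on dual.
HB.instance Definition _ := Choice.on dual.
HB.instance Definition _ := GRing.SubChoice_isSubLmodule.Build
  K (V -> K^o) _ dual (GRing.subsemimodClosedP dual_pred).

Definition dual_fun (f : dual) : V -> K^o := val f.

Lemma dual_linear (f : dual) : linear (dual_fun f).
Proof. by have /asboolP[] := valP f. Qed.

Lemma dual_continuous (f : dual) : continuous (dual_fun f).
Proof. by have /asboolP[] := valP f. Qed.

Definition unit_ball : set V := [set x | `|x| <= 1].

Let B0 : unit_ball !=set0. Proof. by exists 0; rewrite /unit_ball/= normr0. Qed.

Definition dual_linear_fun (f : dual) : {linear V -> K^o} :=
  HB.pack (dual_fun f)
    (GRing.isLinear.Build K V K^o *:%R (dual_fun f) (dual_linear f)).

Lemma dual_bounded (f : dual) : bounded_on unit_ball (dual_fun f).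
Proof.
have /linear_bounded_continuous/linear_boundedP : continuous (dual_linear_fun f).
  exact: dual_continuous.
move=> /pinfty_ex_gt0[M M0 fM]; exists (scalar_re M) => x x1.
rewrite -(ler_of_real k) of_real_rnorm of_real_scalar_re ?(ltW M0)//.
by rewrite (le_trans (fM x))// ler_piMr// ltW.
Qed.

Definition dual_norm (f : dual) : K := of_real (sup_norm unit_ball (dual_fun f)).

Let dual_normD f g : dual_norm (f + g) <= dual_norm f + dual_norm g.
Proof.
rewrite /dual_norm -of_realD ler_of_real /dual_fun raddfD.
by apply: sup_normD => //; exact: dual_bounded.
Qed.

Let dual_normZ a f : dual_norm (a *: f) = `|a| * dual_norm f.
Proof.
rewrite /dual_norm /dual_fun linearZ sup_normZ//; last exact: dual_bounded.
by rewrite of_realM of_real_scalar_re.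
Qed.

Let dual_norm0_eq0 f : dual_norm f = 0 -> f = 0.
Proof.
move=> /(congr1 (@scalar_re R k)); rewrite of_realK -(of_real0 R k) of_realK => f0.
apply: val_inj; rewrite raddf0; apply/funext => x.
rewrite -[LHS]/(dual_linear_fun f x) -[RHS]/0.
have [->|x0] := eqVneq x 0; first by rewrite linear0.
have fB y : unit_ball y -> dual_linear_fun f y = 0.
  move=> By; apply: rnorm0_eq0; apply/eqP; rewrite eq_le rnorm_ge0 andbT -f0.
  by apply: sup_norm_ub => //; exact: dual_bounded.
have nx0 : `|x| != 0 by rewrite normr_eq0.
rewrite -[x](scalerKV nx0) linearZ (fB (`|x|^-1 *: x)); first exact: scaler0.
by rewrite /unit_ball/= normrZ normfV normr_id mulVf.
Qed.

HB.instance Definition _ :=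
  Lmodule_isNormed.Build K dual dual_normD dual_normZ dual_norm0_eq0.

(* [V] with the coarsest topology making all its continuous functionals
   continuous. *)
Definition weakly := sup_topology
  (fun f : dual => Topological.class (initial_topology (dual_fun f))).

HB.instance Definition _ := Topological.on weakly.

Definition relatively_weakly_compact (A : set V) :=
  compact (closure (A : set weakly)).

End dual.

Coercion dual_fun : dual >-> Funclass.

Section notions.
Variables (R : realType) (k : scalar_kind).
Local Notation K := (scalars R k).

Definition reflexive_space (V : normedModType K) :=
  forall Phi : dual (dual V), exists x : V, forall f : dual V, Phi f = f x.

Definition equiv_l1N (V : normedModType K) (C : R) (N : nat) (x : 'I_N -> V) :=
  forall a : 'I_N -> K,
    C^-1 * (\sum_i scalar_re `|a i|) <= rnorm (\sum_i a i *: x i) /\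
    rnorm (\sum_i a i *: x i) <= C * (\sum_i scalar_re `|a i|).

Definition contains_l1N_uniformly (V : normedModType K) (A : set V) :=
  exists2 C : R, 0 < C &
    forall N : nat, exists2 x : 'I_N -> V, (forall i, A (x i)) & equiv_l1N C x.

(* Equivalence to the canonical basis of l_1, tested on finite sums. *)
Definition equiv_l1 (V : normedModType K) (x : nat -> V) :=
  exists2 C : R, 0 < C & forall N : nat, equiv_l1N C (fun i : 'I_N => x i).

Definition contains_l1_basis (V : normedModType K) (A : set V) :=
  exists2 x : nat -> V, (forall n, A (x n)) & equiv_l1 x.

Definition weakly_precompact (V : normedModType K) (A : set V) :=
  bounded_set A /\ ~ contains_l1_basis A.

Definition relatively_super_weakly_compact (V : normedModType K) (A : set V) :=
  forall U : free_ultrafilter, relatively_weakly_compact (@ultra_set R k V U A).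

Definition property_R (V : normedModType K) :=
  forall A : set V, weakly_precompact A -> relatively_super_weakly_compact A.

(* Rademacher type: the average runs over all choices of signs. *)
Definition has_type (p : R) (V : normedModType K) :=
  exists2 T : R, 0 < T & forall (n : nat) (x : 'I_n -> V),
    ((2 ^+ n)^-1 * \sum_(e : {ffun 'I_n -> bool})
       rnorm (\sum_i (-1) ^+ e i *: x i) `^ p) `^ p^-1
    <= T * (\sum_i rnorm (x i) `^ p) `^ p^-1.

Definition nontrivial_type (V : normedModType K) :=
  exists2 p : R, 1 < p <= 2 & has_type p V.

Definition finite_dimensional (V : normedModType K) (E : submodClosed V) :=
  exists (n : nat) (e : 'I_n -> V),
    forall x : V, x \in E <-> exists a : 'I_n -> K, x = \sum_i a i *: e i.

Definition finitely_representable (Y Z : normedModType K) :=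
  forall (E : submodClosed Y) (eps : R), finite_dimensional E -> 0 < eps ->
    exists T : {linear subspace_of E -> Z}, forall x : subspace_of E,
      (1 - eps) * rnorm x <= rnorm (T x) /\
      rnorm (T x) <= (1 + eps) * rnorm x.

Definition superreflexive (Z : normedModType K) :=
  forall Y : completeNormedModType K,
    finitely_representable Y Z -> reflexive_space Y.

End notions.

(* Main.v *)
Require Import Defs.
From HB Require Import structures.
From mathcomp Require Import all_boot all_order all_algebra.
From mathcomp Require Import all_classical all_reals all_analysis.
From mathcomp Require Import complex.
From mathcomp Require Import ring lra.
Import Order.TTheory GRing.Theory Num.Theory.
Import numFieldNormedType.Exports.
Local Open Scope classical_set_scope.
Local Open Scope ring_scope.
Set Implicit Arguments.
Unset Strict Implicit.
Unset Printing Implicit Defensive.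

(** Both parts rest on one obstruction, the existence of finite sequences of every
    length in a set whose initial segments have convex hulls at a distance, fixed
    for all lengths, from the hulls of the remaining terms ([hull_separated]).

    A bounded relatively super weakly compact set contains no such sequences
    ([not_hull_separated_of_super_weakly_compact]). In an ultrapower over the
    natural numbers they combine into one infinite separated sequence, whose terms
    have a weak cluster point; by Mazur's theorem ([mazur]) this point is a norm
    limit of convex combinations of every tail, so that some initial hull and a
    later one come arbitrarily close.

    Bases of [l_1^N] with a uniform constant are separated, because the difference
    of two disjoint convex combinations has coefficients of total modulus two.
    A bounded set that contains them and contains no basis of [l_1] would be weakly
    precompact, hence relatively super weakly compact by property (R): this is the
    first part.

    For the second part, nontrivial type excludes uniform copies of [l_1^N]
    ([type_not_l1N]), so the balls of the subspace [Z] are weakly precompact, hence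
    relatively super weakly compact. If some [Y] finitely representable in [Z] were
    not reflexive, James's construction ([nonreflexive_separated]) would give
    separated sequences of every length in its unit ball: a functional on the dual at
    positive distance from all evaluations is imitated, alternately, by functionals
    on [Y] and by vectors of [Y], using an approximate form of Helly's theorem
    ([helly]). Finite representability carries these sequences into a ball of [Z].
    Only their finite segments matter, so ultrapowers over the natural numbers
    suffice even when [Y] is not separable.

    The separations are instances of one form of the Hahn-Banach theorem
    ([hahn_banach_cone]), proved through minimal sublinear functionals and applied to
    real parts, which treats real and complex scalars together. *)

(** * Real parts of scalars and real-valued norms *)

Section real_parts.
Context {R : realType} {k : scalar_kind}.
Local Notation K := (scalars R k).
Implicit Types (a b : K) (r s t : R).

Lemma scalar_reD a b : scalar_re (a + b) = scalar_re a + scalar_re b.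
Proof. by move: a b; case: k => //= -[x y] [z w]. Qed.

Lemma scalar_reM r a : scalar_re (of_real r * a) = r * scalar_re a.
Proof. by move: a; case: k => //= -[x y] /=; rewrite mul0r subr0. Qed.

Lemma scalar_re0 : scalar_re (0 : K) = 0.
Proof. by rewrite -(of_real0 R k) of_realK. Qed.

Lemma scalar_reN a : scalar_re (- a) = - scalar_re a.
Proof. by apply/eqP; rewrite -addr_eq0 -scalar_reD addNr scalar_re0. Qed.

Lemma of_real1 : of_real 1 = 1 :> K.
Proof. by case: k. Qed.

Lemma of_realN r : of_real (- r) = - of_real r :> K.
Proof. by apply/eqP; rewrite -addr_eq0 -of_realD addNr of_real0. Qed.

Lemma ltr_of_real r s : (of_real r < of_real s :> K) = (r < s).
Proof. by rewrite !lt_def ler_of_real (can_eq (@of_realK R k)). Qed.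

Lemma norm_of_real r : `|of_real r : K| = of_real `|r|.
Proof.
have [r0|r0] := leP 0 r.
  by rewrite !ger0_norm// -(of_real0 R k) ler_of_real.
rewrite (ltr0_norm r0) of_realN -normrN ger0_norm//.
by rewrite -of_realN -(of_real0 R k) ler_of_real oppr_ge0 ltW.
Qed.

Lemma scalar_re_norm_of_real r : scalar_re `|of_real r : K| = `|r|.
Proof. by rewrite norm_of_real of_realK. Qed.

Lemma scalar_re_sum (I : Type) (s : seq I) (P : pred I) (F : I -> K) :
  scalar_re (\sum_(i <- s | P i) F i) = \sum_(i <- s | P i) scalar_re (F i).
Proof. by apply: (big_morph _ scalar_reD scalar_re0). Qed.

Lemma scalar_re_le_norm a : scalar_re a <= scalar_re `|a|.
Proof.
move: a; case: k => /= [a|[x y]]; first exact: ler_norm.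
rewrite (le_trans (ler_norm _))// -sqrtr_sqr ler_sqrt.
  by rewrite lerDl sqr_ge0.
by rewrite addr_ge0 ?sqr_ge0.
Qed.

(** Rotating a scalar onto the positive half-line: this is how a bound on the
    real part of a functional becomes a bound on its modulus. *)
Lemma scalar_phase a : exists2 c : K, `|c| = 1 & c * a = `|a|.
Proof.
have [->|a0] := eqVneq a 0; first by exists 1; rewrite ?normr1// mulr0 normr0.
exists (`|a| / a); last by rewrite divfK.
by rewrite normrM normfV normr_id divff// normr_eq0.
Qed.

Lemma scalar_re_norm1 : scalar_re `|1 : K| = 1.
Proof. by rewrite normr1 -of_real1 of_realK. Qed.

Variable V : normedModType K.
Implicit Types x y : V.

Lemma rnormN x : rnorm (- x) = rnorm x.
Proof. by rewrite /rnorm normrN. Qed.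

Lemma rnormB x y : rnorm (x - y) = rnorm (y - x).
Proof. by rewrite -rnormN opprB. Qed.

Lemma rnormZr r x : rnorm (of_real r *: x) = `|r| * rnorm x.
Proof. by rewrite rnormZ scalar_re_norm_of_real. Qed.

Lemma norm_le_rnorm x r : (`|x| <= of_real r) = (rnorm x <= r).
Proof. by rewrite -of_real_rnorm ler_of_real. Qed.

Lemma unit_ballE x : unit_ball x <-> rnorm x <= 1.
Proof. by rewrite /unit_ball/= -of_real1 norm_le_rnorm. Qed.

End real_parts.

(** * The Hahn-Banach theorem for real and complex scalars *)

Section hahn_banach.
Context {R : realType} {k : scalar_kind}.
Local Notation K := (scalars R k).
Variable V : lmodType K.
Implicit Types (x y : V) (p q u : V -> R) (G : set (V * R)).

Definition sublinear p :=
  (forall x y, p (x + y) <= p x + p y) /\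
  (forall t x, 0 <= t -> p (of_real t *: x) <= t * p x).

(** An element [(y, a)] of a cone stands for the constraint [a <= u y] on an
    unknown real functional [u]; constraints may be added and rescaled. *)
Definition constraint_cone G :=
  [/\ G !=set0,
      forall y z a b, G (y, a) -> G (z, b) -> G (y + z, a + b)
    & forall t y a, 0 <= t -> G (y, a) -> G (of_real t *: y, t * a)].

Lemma sublinear0 p : sublinear p -> p 0 = 0.
Proof.
move=> [pD pZ]; apply/eqP; rewrite eq_le.
have := pZ 0 0 (lexx _); rewrite scaler0 mul0r => -> /=.
by have := pD 0 0; rewrite addr0 -{1}[p 0]addr0 lerD2l.
Qed.

Lemma sublinear_geN p x : sublinear p -> - p (- x) <= p x.
Proof. by move=> sp; rewrite lerNl -subr_ge0 opprK -(sublinear0 sp) -(subrr x) addrC; case: sp. Qed.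

Lemma constraint_cone0 G : constraint_cone G -> G (0, 0).
Proof.
move=> [[[y a] Gya] _ /(_ 0 y a (lexx _) Gya)].
by rewrite of_real0 scale0r mul0r.
Qed.

(** The largest sublinear functional below [p] that forces the constraints of
    [G] on every functional that it dominates. *)
Definition constrain p G x : R :=
  inf [set p (x + z.1) - z.2 | z in G].

Section constrain.
Variables (p : V -> R) (G : set (V * R)).
Hypotheses (sp : sublinear p) (cG : constraint_cone G).
Hypothesis Gp : forall y a, G (y, a) -> a <= p y.

Let lb x : has_lbound [set p (x + z.1) - z.2 | z in G].
Proof.
exists (- p (- x)) => _ [[y a] Gya <-] /=.
rewrite -subr_ge0 opprK addrAC subr_ge0 (le_trans (Gp Gya))//.
by rewrite -{1}[y](addKr x) addrC; case: sp.
Qed.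

Let ne x : [set p (x + z.1) - z.2 | z in G] !=set0.
Proof. by have [[z Gz] _ _] := cG; exists (p (x + z.1) - z.2); exists z. Qed.

Lemma constrain_le x y a : G (y, a) -> constrain p G x <= p (x + y) - a.
Proof. by move=> Gya; apply: ge_inf => //; exists (y, a). Qed.

Lemma constrain_le_self x : constrain p G x <= p x.
Proof.
by have := constrain_le x (constraint_cone0 cG); rewrite addr0 subr0.
Qed.

Let constrain_lt x e : 0 < e ->
  exists y a, G (y, a) /\ p (x + y) - a < constrain p G x + e.
Proof.
move=> e0; have : constrain p G x < constrain p G x + e by rewrite ltrDl.
by move=> /(inf_lt (ne x))[_ [[y a] Gya <-] ?]; exists y, a.
Qed.

(** Convexity of [G] enters here: the sum of nearly optimal constraints for [x]
    and for [y] is admissible for [x + y]. *)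
Lemma sublinear_constrain : sublinear (constrain p G).
Proof.
have [_ GD GZ] := cG; have [pD pZ] := sp; split.
  move=> x y; apply/ler_addgt0Pl => e e0.
  have e2 : 0 < e / 2 by rewrite divr_gt0.
  have [x' [a [Ga ax]]] := constrain_lt x e2.
  have [y' [b [Gb by_]]] := constrain_lt y e2.
  rewrite (le_trans (constrain_le _ (GD _ _ _ _ Ga Gb)))//.
  by have := pD (x + x') (y + y'); rewrite addrACA; lra.
move=> t x t0; apply/ler_addgt0Pl => e e0.
have t1 : 0 < t + 1 by rewrite ltr_pwDr.
have et : 0 < e / (t + 1) by rewrite divr_gt0.
have [y [a [Ga ay]]] := constrain_lt x et.
rewrite (le_trans (constrain_le _ (GZ t _ _ t0 Ga)))// -scalerDr.
have := pZ t (x + y) t0; have := ler_wpM2l t0 (ltW ay).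
have : t * (e / (t + 1)) <= e.
  by rewrite mulrCA ler_piMr ?(ltW e0)// ler_pdivrMr// mul1r lerDl.
by lra.
Qed.

End constrain.

(** On a chain of minorants of [p] the pointwise infimum is finite, since each of
    them stays above [- p (- x)], and subadditive, since two minorants can be
    replaced by the smaller one. *)
Lemma sublinear_chain_inf p (C : set (V -> R)) :
  sublinear p -> C !=set0 ->
  (forall q, C q -> sublinear q /\ forall x, q x <= p x) ->
  (forall q q', C q -> C q' ->
     (forall x, q x <= q' x) \/ (forall x, q' x <= q x)) ->
  exists q, [/\ sublinear q, forall x, q x <= p x
    & forall q', C q' -> forall x, q x <= q' x].
Proof.
move=> sp [q0 Cq0] Cp Ctot.
have lb x : has_lbound [set q x | q in C].
  exists (- p (- x)) => _ [q Cq <-]; have [sq qp] := Cp _ Cq.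
  by rewrite (le_trans _ (sublinear_geN x sq))// lerN2.
have le q x : C q -> inf [set q x | q in C] <= q x.
  by move=> Cq; apply: ge_inf => //; exists q.
have lt x e : 0 < e -> exists2 q, C q & q x < inf [set q x | q in C] + e.
  move=> e0; have : inf [set q x | q in C] < inf [set q x | q in C] + e.
    by rewrite ltrDl.
  by move=> /inf_lt[|_ [q Cq <-] ?]; [exists (q0 x); exists q0|exists q].
exists (fun x => inf [set q x | q in C]); split=> //.
- split=> [x y|t x t0]; apply/ler_addgt0Pl => e e0.
    have e2 : 0 < e / 2 by rewrite divr_gt0.
    have [q Cq qx] := lt x _ e2; have [q' Cq' qy] := lt y _ e2.
    have [qq|qq] := Ctot _ _ Cq Cq'.
      rewrite (le_trans (le _ (x + y) Cq))//.
      by have [[qD _] _] := Cp _ Cq; have := qD x y; have := qq y; lra.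
    rewrite (le_trans (le _ (x + y) Cq'))//.
    by have [[qD _] _] := Cp _ Cq'; have := qD x y; have := qq x; lra.
  have t1 : 0 < t + 1 by rewrite ltr_pwDr.
  have et : 0 < e / (t + 1) by rewrite divr_gt0.
  have [q Cq qx] := lt x _ et; rewrite (le_trans (le _ _ Cq))//.
  have [[_ qZ] _] := Cp _ Cq.
  have := qZ t x t0; have := ler_wpM2l t0 (ltW qx).
  have : t * (e / (t + 1)) <= e.
    by rewrite mulrCA ler_piMr ?(ltW e0)// ler_pdivrMr// mul1r lerDl.
  by lra.
- by move=> x; rewrite (le_trans (le _ x Cq0))//; case: (Cp _ Cq0).
- by move=> q' Cq' x; exact: le.
Qed.

(** A minimal sublinear functional [q] is additive: constraining it by its own
    value at [y] cannot decrease it, that is [q x + q y <= q (x + y)]. *)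
Lemma sublinear_minorant p : sublinear p -> exists u,
  [/\ forall x y, u (x + y) = u x + u y,
      forall t x, u (of_real t *: x) = t * u x
    & forall x, u x <= p x].
Proof.
move=> sp; pose T := {q : V -> R | sublinear q /\ forall x, q x <= p x}.
pose below (q r : T) := `[< forall x, sval r x <= sval q x >].
have sp' : sublinear p /\ forall x, p x <= p x by [].
have [||A totA|[q [sq qp]] qmin] := @ZL_preorder T (exist _ p sp') below.
- by move=> q; apply/asboolP.
- move=> r s t /asboolP rs /asboolP st; apply/asboolP => x.
  exact: le_trans (st x) (rs x).
- have [[q0 Aq0]|A0] := pselect (A !=set0); last first.
    by exists (exist _ p sp') => s As; exfalso; apply: A0; exists s.
  have [||||q [sq qp qA]] := @sublinear_chain_inf p [set sval q | q in A] => //.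
  + by exists (sval q0); exists q0.
  + by move=> _ [[q ?] _ <-].
  + move=> _ _ [q Aq <-] [r Ar <-].
    by have [/asboolP|/asboolP] := totA _ _ Aq Ar; [right|left].
  + exists (exist _ q (conj sq qp)) => s As; apply/asboolP => /=.
    by apply: qA; exists s.
have qD x y : q (x + y) = q x + q y.
  apply/eqP; rewrite eq_le; have [-> //= qZ] := sq.
  (* The constraint [q y <= u y] with its multiples: [q] itself meets it. *)
  pose G := [set (of_real t *: y, t * q y) | t in [set t : R | 0 <= t]].
  have cG : constraint_cone G.
    split; first by exists (of_real 0 *: y, 0 * q y); exists 0 => /=.
      move=> _ _ _ _ [t t0 [<- <-]] [s s0 [<- <-]].
      by exists (t + s); rewrite /= ?addr_ge0// of_realD scalerDl mulrDl.
    move=> s _ _ s0 [t t0 [<- <-]].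
    by exists (s * t); rewrite /= ?mulr_ge0// of_realM scalerA mulrA.
  have Gq z a : G (z, a) -> a <= q z.
    move=> [t /= t0 [<- <-]].
    have [->|tn0] := eqVneq t 0.
      by rewrite of_real0 scale0r mul0r sublinear0.
    have ti : 0 <= t^-1 by rewrite invr_ge0.
    have := qZ t^-1 (of_real t *: y) ti.
    rewrite scalerA -of_realM mulVf// of_real1 scale1r.
    by rewrite ler_pdivlMl// lt_neqAle eq_sym tn0.
  pose r := constrain q G.
  have rq : forall z, r z <= q z by exact: constrain_le_self.
  have sr : sublinear r /\ forall z, r z <= p z.
    by split; [exact: sublinear_constrain|move=> z; exact: le_trans (qp z)].
  have /asboolP /= : below (exist _ r sr) (exist _ q (conj sq qp)).
    by apply: qmin; apply/asboolP.
  have Gy : G (y, q y).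
    by exists 1; rewrite /= ?ler01// of_real1 scale1r mul1r.
  move=> /(_ x) qr; have := constrain_le sq Gq x Gy.
  by move=> /(le_trans qr); rewrite lerBrDr.
have q0 := sublinear0 sq.
have qN x : q (- x) = - q x.
  by apply/eqP; rewrite -addr_eq0 -qD addNr q0.
have qZ t x : 0 <= t -> q (of_real t *: x) = t * q x.
  have [_ qZ t0] := sq; apply/eqP; rewrite eq_le qZ//=.
  by rewrite -lerN2 -qN -scalerN -mulrN -qN qZ.
exists q; split=> // t x; have [t0|t0] := leP 0 t; first exact: qZ.
rewrite -{1}[t]opprK of_realN scaleNr qN qZ ?oppr_ge0 ?ltW//.
by rewrite mulNr opprK.
Qed.

(** The Hahn-Banach theorem in the form of Mazur and Orlicz: lower bounds on a
    real functional can be met under [p] as soon as none of them exceeds [p].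
    Extension and separation theorems are choices of the cone. *)
Lemma hahn_banach_cone p G : sublinear p -> constraint_cone G ->
  (forall y a, G (y, a) -> a <= p y) -> exists u,
  [/\ forall x y, u (x + y) = u x + u y,
      forall t x, u (of_real t *: x) = t * u x,
      forall x, u x <= p x
    & forall y a, G (y, a) -> a <= u y].
Proof.
move=> sp cG Gp.
have [u [uD uZ up]] := sublinear_minorant (sublinear_constrain sp cG Gp).
exists u; split=> // [x|y a Gya].
  exact: le_trans (up x) (constrain_le_self sp cG Gp x).
have := le_trans (up (- y)) (constrain_le sp Gp (- y) Gya).
have -> : u (- y) = - u y.
  by rewrite -[y in LHS]scale1r -scaleNr -of_real1 -of_realN uZ mulN1r.
by rewrite addNr sublinear0// sub0r lerN2.
Qed.

(** Over the complex scalars the functional is [u x - i u (i x)], which is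
    determined by its real part: all separation arguments can therefore be run
    on real parts, whatever the scalars are. *)
Lemma linear_of_real_part (u : V -> R) :
  (forall x y, u (x + y) = u x + u y) ->
  (forall t x, u (of_real t *: x) = t * u x) ->
  exists2 f : V -> K^o, linear f & forall x, scalar_re (f x) = u x.
Proof.
move: V u; case: k => /= W u uD uZ.
  by exists u => // a x y; rewrite uD uZ.
pose f (x : W) : R[i]%C := (u x +i* - u ('i%C *: x))%C.
exists f => // a x y; case: a => a b.
have E (z : W) : (a +i* b)%C *: z = (a%:C)%C *: z + (b%:C)%C *: ('i%C *: z).
  rewrite scalerA -scalerDl; congr (_ *: _).
  by apply/eqP; rewrite eq_complex /=; apply/andP; split; apply/eqP; ring.
have F (z : W) : 'i%C *: ('i%C *: z) = ((-1)%:C)%C *: z.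
  rewrite scalerA; congr (_ *: _).
  by apply/eqP; rewrite eq_complex /=; apply/andP; split; apply/eqP; ring.
have I : 'i%C *: ((a +i* b)%C *: x + y) =
   (a%:C)%C *: ('i%C *: x) + ((- b)%:C)%C *: x + 'i%C *: y.
  rewrite scalerDr E scalerDr; congr (_ + _ + _).
    by rewrite !scalerA mulrC.
  rewrite scalerA mulrC -scalerA F scalerA; congr (_ *: _).
  by apply/eqP; rewrite eq_complex /=; apply/andP; split; apply/eqP; ring.
apply/eqP; rewrite eq_complex /f I E /= !uD !uZ.
by apply/andP; split; apply/eqP; ring.
Qed.

End hahn_banach.

(** * Functionals and the bidual *)

Section dual_space.
Context {R : realType} {k : scalar_kind}.
Local Notation K := (scalars R k).
Variable V : normedModType K.
Implicit Types (f g : dual V) (x y : V).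

Lemma dual_ext f g : (forall x, f x = g x) -> f = g.
Proof. by move=> fg; apply: val_inj; apply/funext. Qed.

Lemma dualD f g x : dual_fun (f + g) x = f x + g x.
Proof. by []. Qed.

Lemma dualN f x : dual_fun (- f) x = - f x.
Proof. by []. Qed.

Lemma dualZ (a : K) f x : dual_fun (a *: f) x = a * f x.
Proof. by []. Qed.

Lemma dual_sum (I : Type) (s : seq I) (F : I -> dual V) x :
  dual_fun (\sum_(i <- s) F i) x = \sum_(i <- s) F i x.
Proof.
by elim/big_rec2 : _ => [//|i a b _ <-]; rewrite dualD.
Qed.

Lemma dual_apD f x y : f (x + y) = f x + f y.
Proof. exact: (linearD (dual_linear_fun f)). Qed.

Lemma dual_apB f x y : f (x - y) = f x - f y.
Proof. exact: (linearB (dual_linear_fun f)). Qed.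

Lemma dual_apZ f (a : K) x : f (a *: x) = a * f x.
Proof. by rewrite -[LHS]/(dual_linear_fun f _) linearZ. Qed.

Lemma dual_ap_sum f (I : Type) (s : seq I) (P : pred I) (F : I -> V) :
  f (\sum_(i <- s | P i) F i) = \sum_(i <- s | P i) f (F i).
Proof. exact: (linear_sum (dual_linear_fun f)). Qed.

Lemma re_dual_apZ f (r : R) x :
  scalar_re (f (of_real r *: x)) = r * scalar_re (f x).
Proof. by rewrite dual_apZ scalar_reM. Qed.

Lemma rnorm_dual f : rnorm f = sup_norm (@unit_ball R k V) (dual_fun f).
Proof. by rewrite /rnorm /Num.norm/= of_realK. Qed.

Let ball0 : @unit_ball R k V !=set0.
Proof. by exists 0; apply/unit_ballE; rewrite rnorm0 ler01. Qed.

Lemma rnorm_dual_le f c : 0 <= c ->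
  (forall x, rnorm (f x) <= c * rnorm x) -> rnorm f <= c.
Proof.
move=> c0 fc; rewrite rnorm_dual; apply: sup_norm_le => // x /unit_ballE x1.
by rewrite (le_trans (fc x))// ler_piMr.
Qed.

Lemma ler_rnorm_dual f x : rnorm (f x) <= rnorm f * rnorm x.
Proof.
have [x0|x0] := eqVneq (rnorm x) 0.
  rewrite (rnorm0_eq0 x0) -[X in f X](scale0r x) dual_apZ mul0r.
  by rewrite -[X in rnorm X]/(0 : K^o) !rnorm0 mulr0.
rewrite -ler_pdivrMr; last by rewrite lt_neqAle eq_sym x0 rnorm_ge0.
have ni : 0 <= (rnorm x)^-1 by rewrite invr_ge0 rnorm_ge0.
have -> : rnorm (f x) / rnorm x = rnorm (f (of_real (rnorm x)^-1 *: x)).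
  rewrite dual_apZ -[X in _ = rnorm X]/(_ *: (f x : K^o)) rnormZr.
  by rewrite ger0_norm// mulrC.
rewrite rnorm_dual; apply: sup_norm_ub; first exact: dual_bounded.
by apply/unit_ballE; rewrite rnormZr ger0_norm// mulVf.
Qed.

Lemma re_dual_le f x : scalar_re (f x) <= rnorm f * rnorm x.
Proof. exact: le_trans (scalar_re_le_norm _) (ler_rnorm_dual f x). Qed.

(** The supremum that defines the norm bounds moduli; a rotation of the vector
    turns a modulus into a real part. *)
Lemma dual_norming f (e : R) : 0 < e ->
  exists2 x, rnorm x <= 1 & rnorm f - e < scalar_re (f x).
Proof.
move=> e0; have : rnorm f - e < sup_norm (@unit_ball R k V) (dual_fun f).
  by rewrite -rnorm_dual ltrBlDr ltrDl.
move=> /sup_gt[|_ [x /unit_ballE x1 <-] fx].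
  by have [x xB] := ball0; exists (rnorm (f x)); exists x.
have [c c1 cf] := scalar_phase (f x).
exists (c *: x); last by rewrite dual_apZ cf.
by rewrite rnormZ c1 -(normr1 K) scalar_re_norm1 mul1r.
Qed.

Lemma dual_of_linear (f : V -> K^o) (c : R) : 0 <= c -> linear f ->
  (forall x, rnorm (f x) <= c * rnorm x) ->
  exists2 g : dual V, (forall x, g x = f x) & rnorm g <= c.
Proof.
move=> c0 lf fc.
pose lF : {linear V -> K^o} := HB.pack f (GRing.isLinear.Build K V K^o *:%R f lf).
have cf : continuous f.
  apply: (@linear_bounded_continuous _ _ _ lF).1; apply/linear_boundedP.
  exists (of_real c); split; first by rewrite ger0_real// -(of_real0 R k) ler_of_real.
  move=> r cr x; rewrite (le_trans _ (ler_wpM2r (normr_ge0 x) (ltW cr)))//.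
  by rewrite -!of_real_rnorm -of_realM ler_of_real; exact: fc.
have fd : f \in @dual_pred R k V by apply/asboolP.
exists (exist _ f fd) => //; exact: rnorm_dual_le.
Qed.

Lemma sublinear_rnorm (c : R) : 0 <= c -> sublinear (fun x : V => c * rnorm x).
Proof.
move=> c0; split=> [x y|t x t0]; first by rewrite -mulrDr ler_wpM2l ?ler_rnormD.
by rewrite rnormZr ger0_norm// mulrCA.
Qed.

(** Domination by [c * rnorm] bounds the real part of the functional only; at the
    rotated vector [b *: x] real part and modulus coincide. *)
Lemma hahn_banach_dual (c : R) (G : set (V * R)) :
  0 <= c -> constraint_cone G ->
  (forall y a, G (y, a) -> a <= c * rnorm y) ->
  exists2 f : dual V, rnorm f <= c & forall y a, G (y, a) -> a <= scalar_re (f y).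
Proof.
move=> c0 cG Gc.
have [u [uD uZ uc uG]] := hahn_banach_cone (sublinear_rnorm c0) cG Gc.
have [f lf fu] := linear_of_real_part uD uZ.
have [|g gf gc] := dual_of_linear c0 lf; last first.
  by exists g => // y a Gya; rewrite gf fu uG.
move=> x; have [b b1 bf] := scalar_phase (f x : K).
have fbx : f (b *: x) = b * f x.
  have f0 : f 0 = 0 by have := lf (-1) 0 0; rewrite scaler0 addr0 scaleN1r addNr.
  by have := lf b x 0; rewrite f0 !addr0.
have -> : rnorm (f x) = u (b *: x) by rewrite -fu fbx bf.
rewrite (le_trans (uc _))// rnormZ b1.
by rewrite -(normr1 K) scalar_re_norm1 mul1r.
Qed.

(** The constraint [rnorm x <= u x], with its nonnegative multiples, does not
    exceed the norm. *)
Lemma exists_norming_functional x :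
  exists2 f : dual V, rnorm f <= 1 & rnorm x <= scalar_re (f x).
Proof.
pose G := [set (of_real t *: x, t * rnorm x) | t in [set t : R | 0 <= t]].
have cG : constraint_cone G.
  split; first by exists (of_real 0 *: x, 0 * rnorm x); exists 0 => /=.
    move=> _ _ _ _ [t t0 [<- <-]] [s s0 [<- <-]].
    by exists (t + s); rewrite /= ?addr_ge0// of_realD scalerDl mulrDl.
  move=> s _ _ s0 [t t0 [<- <-]].
  by exists (s * t); rewrite /= ?mulr_ge0// of_realM scalerA mulrA.
have [|f f1 fG] := hahn_banach_dual ler01 cG.
  by move=> _ _ [t /= t0 [<- <-]]; rewrite mul1r rnormZr ger0_norm.
exists f => //; apply: fG; exists 1; rewrite /= ?ler01//.
by rewrite of_real1 scale1r mul1r.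
Qed.

End dual_space.

Section bidual.
Context {R : realType} {k : scalar_kind}.
Local Notation K := (scalars R k).
Variable V : normedModType K.

Lemma bidual_eval_subproof (x : V) :
  exists g : dual (dual V), forall f : dual V, g f = f x.
Proof.
have [||g gx _] :=
    @dual_of_linear _ _ (dual V) (fun f => dual_fun f x) (rnorm x) (rnorm_ge0 x).
- by move=> a f g; rewrite dualD dualZ.
- by move=> f; rewrite mulrC ler_rnorm_dual.
by exists g.
Qed.

Definition bidual_eval (x : V) : dual (dual V) := sval (cid (bidual_eval_subproof x)).

Lemma bidual_evalE x (f : dual V) : bidual_eval x f = f x.
Proof. by rewrite /bidual_eval; case: cid. Qed.

Lemma bidual_evalB x y : bidual_eval (x - y) = bidual_eval x - bidual_eval y.
Proof. by apply: dual_ext => f; rewrite dualD dualN !bidual_evalE dual_apB. Qed.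

Lemma bidual_evalZ (a : K) x : bidual_eval (a *: x) = a *: bidual_eval x.
Proof. by apply: dual_ext => f; rewrite dualZ !bidual_evalE dual_apZ. Qed.

Lemma rnorm_bidual_eval x : rnorm x <= rnorm (bidual_eval x).
Proof.
have [f f1 fx] := exists_norming_functional x.
rewrite (le_trans fx)// -bidual_evalE (le_trans (re_dual_le _ _))//.
by rewrite ler_piMr ?rnorm_ge0.
Qed.

End bidual.

(** * Approximate solutions of systems of inequalities *)

Section helly.
Context {R : realType}.

(** The linear functionals below this sublinear one are the averages with
    nonnegative weights of sum one. *)
Definition row_max n (y : 'rV[R]_n.+1) : R := \big[Num.max/y ord0 ord0]_j y ord0 j.

Lemma row_max_leP n (y : 'rV[R]_n.+1) r : row_max y <= r <-> forall j, y ord0 j <= r.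
Proof.
split=> [yr j|yr]; last by apply: bigmax_le.
by rewrite (le_trans _ yr)// le_bigmax.
Qed.

Lemma le_row_max n (y : 'rV[R]_n.+1) j : y ord0 j <= row_max y.
Proof. exact: (row_max_leP y (row_max y)).1. Qed.

Lemma sublinear_row_max n :
  @sublinear R RealScalars 'rV[scalars R RealScalars]_n.+1 (@row_max n).
Proof.
split=> [x y|t x t0]; apply/row_max_leP => j; rewrite mxE.
  by rewrite lerD// le_row_max.
by rewrite ler_wpM2l// le_row_max.
Qed.

Lemma row_functional n (u : 'rV[R]_n -> R) :
  (forall x y, u (x + y) = u x + u y) -> (forall t x, u (t *: x) = t * u x) ->
  forall y, u y = \sum_j y ord0 j * u (delta_mx ord0 j).
Proof.
move=> uD uZ y; have u0 : u 0 = 0 by have := uZ 0 0; rewrite scaler0 mul0r.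
rewrite {1}[y]row_sum_delta (big_morph u uD u0).
by apply: eq_bigr => j _; rewrite uZ.
Qed.

Context {k : scalar_kind}.
Local Notation K := (scalars R k).
Variable W : normedModType K.

(** A form of Helly's theorem for inequalities. If no vector of the ball solves
    the system up to [e], then for every [w] of the ball some coordinate of the
    row [b - e - g w] is nonnegative, so that a functional below the maximum
    of the coordinates is nonnegative on all these rows. It is given by weights
    [t], and averaging the inequalities with them contradicts the hypothesis. *)
Lemma helly n (g : nat -> dual W) (b : nat -> R) (e : R) : 0 < e ->
  (forall t : nat -> R, (forall j, 0 <= t j) ->
     \sum_(j < n.+1) t j * b j <=
     rnorm (\sum_(j < n.+1) of_real (t j) *: g j)) ->
  exists2 w, rnorm w <= 1 & forall j, (j <= n)%N -> b j - e < scalar_re (g j w).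
Proof.
move=> e0 gb; apply: contrapT => noW.
have {}noW w : rnorm w <= 1 ->
    exists j : 'I_n.+1, scalar_re (g j w) <= b j - e.
  move=> w1; apply: contrapT => nj; apply: noW; exists w => // j jn.
  rewrite ltNge; apply/negP => gj; apply: nj.
  by exists (Ordinal (jn : (j < n.+1)%N)).
pose bv : 'rV[R]_n.+1 := \row_j (b j - e).
pose uv w : 'rV[R]_n.+1 := \row_j scalar_re (g j w).
have uvD v w : uv (v + w) = uv v + uv w.
  by apply/rowP => j; rewrite !mxE dual_apD scalar_reD.
have uvZ t w : uv (of_real t *: w) = t *: uv w.
  by apply/rowP => j; rewrite !mxE re_dual_apZ.
(* The cone generated by the rows [bv - uv w], where [rnorm w <= 1]. *)
pose G := [set z : 'rV[scalars R RealScalars]_n.+1 * R |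
  z.2 = 0 /\ exists s w, rnorm w <= s /\ z.1 = s *: bv - uv w].
have uv0 : uv 0 = 0 by have := uvZ 0 0; rewrite scaler0 scale0r.
have cG : constraint_cone G.
  split.
  - exists (0, 0); split=> //; exists 0, 0.
    by rewrite rnorm0 uv0 scale0r subr0.
  - move=> _ _ _ _ [/= -> [s [v [vs ->]]]] [/= -> [r [w [wr ->]]]].
    split; first by rewrite addr0.
    exists (s + r), (v + w); split; first by rewrite (le_trans (ler_rnormD _ _))// lerD.
    by rewrite uvD scalerDl opprD addrACA.
  - move=> t _ _ t0 [/= -> [s [v [vs ->]]]]; split; first by rewrite mulr0.
    exists (t * s), (of_real t *: v); rewrite rnormZr ger0_norm// ler_wpM2l//.
    by split=> //; rewrite uvZ scalerBr scalerA.
have Gp y a : G (y, a) -> a <= row_max y.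
  move=> [/= -> [s [w [ws ->]]]].
  have [s0|s0] := leP s 0.
    have w0 : w = 0 by apply: rnorm0_eq0; apply/eqP; rewrite eq_le rnorm_ge0 (le_trans ws).
    have -> : s = 0.
      by apply/eqP; rewrite eq_le s0 (le_trans _ ws)// rnorm_ge0.
    by have := le_row_max (0 *: bv - uv w) ord0; rewrite w0 uv0 scale0r subr0 mxE.
  have [|j gj] := noW (of_real s^-1 *: w).
    by rewrite rnormZr ger0_norm ?invr_ge0 ?(ltW s0)// ler_pdivrMl// mulr1.
  rewrite (le_trans _ (le_row_max _ j))// !mxE subr_ge0 -ler_pdivrMl//.
  by rewrite -re_dual_apZ.
have [u [uD uZ umax uG]] := hahn_banach_cone (sublinear_row_max n) cG Gp.
pose t j := u (delta_mx ord0 (inord j)).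
have uE y : u y = \sum_(j < n.+1) y ord0 j * t j.
  by rewrite (row_functional uD uZ); under [RHS]eq_bigr do rewrite /t inord_val.
have uN y : u (- y) = - u y.
  by rewrite !uE -sumrN; apply: eq_bigr => j _; rewrite mxE mulNr.
have t0 j : 0 <= t j.
  rewrite -oppr_le0 -uN (le_trans (umax _))//; apply/row_max_leP => i.
  by rewrite !mxE oppr_le0 /= ler0n.
have t1 : 1 <= \sum_(j < n.+1) t j.
  rewrite -lerN2; have -> : - \sum_(j < n.+1) t j = u (const_mx (-1)).
    by rewrite uE -sumrN; apply: eq_bigr => j _; rewrite mxE mulN1r.
  by rewrite (le_trans (umax _))//; apply/row_max_leP => i; rewrite mxE.
have [w w1 wh] := dual_norming (\sum_(j < n.+1) of_real (t j) *: g j) e0.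
have : u (uv w) <= u bv.
  rewrite -subr_ge0 -uN -uD; apply: uG; split=> //; exists 1, w.
  by rewrite scale1r.
rewrite !uE; under eq_bigr do rewrite mxE.
under [X in _ <= X]eq_bigr do rewrite mxE mulrBl.
rewrite sumrB -mulr_sumr => le.
have hw : scalar_re (dual_fun (\sum_(j < n.+1) of_real (t j) *: g j) w) =
    \sum_(j < n.+1) scalar_re (g j w) * t j.
  rewrite dual_sum scalar_re_sum; apply: eq_bigr => j _.
  by rewrite mulrC -scalar_reM.
move: wh; rewrite hw.
have := gb t t0; under eq_bigr do rewrite mulrC.
have : e <= e * \sum_(j < n.+1) t j by rewrite ler_peMr// ltW.
by lra.
Qed.

End helly.

(** * Separated sequences and reflexivity *)

Section hull_separation.
Context {R : realType} {k : scalar_kind}.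
Local Notation K := (scalars R k).

(** The convex hull of each initial segment of [x 0, ..., x (N - 1)] is at
    distance at least [th] from the hull of the remaining terms. Only finitely many
    terms are involved, so the property passes through finite representability and
    ultrapowers; having it for all [N] with one [th] is what super weak
    compactness excludes. *)
Definition hull_separated (V : normedModType K) (N : nat) (th : R) (x : nat -> V) :=
  forall (l m : nat) (a : nat -> R), (l <= m <= N)%N -> (forall i, 0 <= a i) ->
    \sum_(0 <= i < l) a i = 1 -> \sum_(l <= i < m) a i = 1 ->
    th <= rnorm (\sum_(0 <= i < l) of_real (a i) *: x i -
                 \sum_(l <= i < m) of_real (a i) *: x i).

(** The functional [f l] separates the hull of the terms before [l] from the hull
    of the terms from [l] on. *)
Lemma separated_by_functionals (V : normedModType K) (N : nat) (al be : R)
    (x : nat -> V) (f : nat -> dual V) :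
  (forall l, (l < N)%N -> rnorm (f l) <= 1) ->
  (forall l i, (i < l < N)%N -> scalar_re (f l (x i)) <= al) ->
  (forall l i, (l <= i < N)%N -> be <= scalar_re (f l (x i))) ->
  hull_separated N (be - al) x.
Proof.
move=> f1 fal fbe l m a /andP[lm mN] a0 al1 am1.
have lm' : (l < m)%N.
  rewrite ltn_neqAle lm andbT; apply/eqP => lm'; move: am1.
  by rewrite lm' big_geq// => /esym/eqP; rewrite oner_eq0.
have lN := leq_trans lm' mN.
have fsum i1 i2 : scalar_re (f l (\sum_(i1 <= i < i2) of_real (a i) *: x i)) =
    \sum_(i1 <= i < i2) a i * scalar_re (f l (x i)).
  by rewrite dual_ap_sum scalar_re_sum; apply: eq_bigr => i _; rewrite re_dual_apZ.
set u := \sum_(0 <= i < l) _ *: _; set v := \sum_(l <= i < m) _ *: _.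
rewrite rnormB; apply: le_trans (_ : scalar_re (f l (v - u)) <= _); last first.
  by rewrite (le_trans (re_dual_le _ _))// ler_piMl ?rnorm_ge0// f1.
rewrite dual_apB scalar_reD scalar_reN lerB// fsum.
  rewrite -[be]mul1r -am1 big_distrl/= !big_nat; apply: ler_sum => i /andP[li im].
  by rewrite ler_wpM2l// fbe// li (leq_trans im).
rewrite -[al]mul1r -al1 big_distrl/= !big_nat; apply: ler_sum => i /= il.
by rewrite ler_wpM2l// fal// il.
Qed.

End hull_separation.

Section james.
Context {R : realType} {k : scalar_kind}.
Local Notation K := (scalars R k).

Lemma ler_rnorm_bidual_eval (V : normedModType K) (x : V) :
  rnorm (bidual_eval x) <= rnorm x.
Proof.
apply: rnorm_dual_le; first exact: rnorm_ge0.
by move=> f; rewrite bidual_evalE mulrC ler_rnorm_dual.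
Qed.

Lemma near_inftyS_inv (e : R) : 0 < e ->
  exists N, forall n, (N <= n)%N -> n.+1%:R^-1 < e.
Proof.
move=> e0; have [N _ HN] := near_infty_natSinv_lt (PosNum e0).
by exists N => n Nn; exact: HN.
Qed.

(** The embedding into the bidual is isometric, so a complete space has a closed
    image there. *)
Lemma bidual_dist (Y : completeNormedModType K) (Phi : dual (dual Y)) :
  (forall y, Phi <> bidual_eval y) ->
  exists2 d : R, 0 < d & forall y, d <= rnorm (Phi - bidual_eval y).
Proof.
move=> PhiJ; apply: contrapT => nod.
have /choice[y yPhi] n : exists y, rnorm (Phi - bidual_eval y) < n.+1%:R^-1.
  apply: contrapT => ny; apply: nod; exists n.+1%:R^-1 => // y.
  by rewrite leNgt; apply/negP => yn; apply: ny; exists y.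
have yy n m : rnorm (y n - y m) < n.+1%:R^-1 + m.+1%:R^-1.
  rewrite (le_lt_trans (rnorm_bidual_eval _))// bidual_evalB.
  rewrite -(subrKA Phi) (le_lt_trans (ler_rnormD _ _))// ltrD//.
  by rewrite rnormB.
have ballE (x z : Y) (e : K) : 0 < e -> rnorm (x - z) < scalar_re e -> ball x e z.
  move=> e0 xz; rewrite -ball_normE /ball_/= -of_real_rnorm.
  by rewrite -(of_real_scalar_re (ltW e0)) ltr_of_real.
have re0 (e : K) : 0 < e -> 0 < scalar_re e.
  by move=> e0; rewrite -(ltr_of_real (k := k)) of_real_scalar_re ?of_real0// ltW.
have /cauchy_cvg/cvg_ex[l yl] : cauchy (y @ \oo).
  apply: cauchy_exP => e e0; have e20 : 0 < scalar_re e / 2 by rewrite divr_gt0// re0.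
  have [N HN] := near_inftyS_inv e20.
  exists (y N); exists N => // n /= Nn; apply: ballE => //.
  rewrite (lt_trans (yy _ _))// [ltRHS]splitr ltrD//; exact: HN.
apply: (PhiJ l); apply/eqP; rewrite -subr_eq0; apply/eqP/rnorm0_eq0.
apply/eqP; rewrite eq_le rnorm_ge0 andbT; apply/ler_addgt0Pl => e e0; rewrite addr0.
have e2 : 0 < e / 2 by rewrite divr_gt0.
have [N HN] := near_inftyS_inv e2.
have eK : 0 < of_real (e / 2) :> K.
  by rewrite -(of_real0 R k) ltr_of_real.
have /cvgrPdist_lt /(_ _ eK) [M _ HM] := yl.
pose n := maxn N M.
rewrite -(subrKA (bidual_eval (y n))) (le_trans (ler_rnormD _ _))// [leRHS]splitr lerD//.
  by rewrite ltW// (lt_trans (yPhi n))// HN// leq_maxl.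
rewrite -bidual_evalB (le_trans (ler_rnorm_bidual_eval _))// rnormB.
by rewrite -norm_le_rnorm ltW// HM//= leq_maxr.
Qed.

Section sequence.
Variables (Y : normedModType K) (Phi : dual (dual Y)) (d : R).
Hypotheses (d0 : 0 < d) (dPhi : forall y, d <= rnorm (Phi - bidual_eval y)).
Let M := rnorm Phi + 1.
(* Small enough that [e <= d / 4], since [1 <= M], and that [3 * e * M <= d - e]. *)
Let e := d / (4 * M).

Let M1 : 1 <= M. Proof. by rewrite lerDr rnorm_ge0. Qed.
Let M0 : 0 < M. Proof. exact: lt_le_trans ltr01 M1. Qed.
Let e0 : 0 < e. Proof. by rewrite divr_gt0// mulr_gt0. Qed.
Let ed : e * M = d / 4.
Proof. by rewrite /e; field; rewrite gt_eqF. Qed.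
Let e_le : e <= d / 4.
Proof. by rewrite -ed ler_peMr// ltW. Qed.

(** A functional on the dual that is at distance [d] from all evaluations takes
    almost the value [d] at some [f] of the unit ball that almost vanishes on
    finitely many given vectors. *)
Let next_functional N (x : nat -> Y) : exists f : dual Y,
  [/\ rnorm f <= 1, d - e < scalar_re (Phi f)
    & forall i, (i < N)%N -> scalar_re (f (x i)) <= e].
Proof.
pose g i : dual (dual Y) := if i is j.+1 then - bidual_eval (x j) else Phi.
pose b i : R := if i is j.+1 then 0 else d.
have [|f f1 fg] := @helly R k (dual Y) N g b e e0.
  move=> t t0; rewrite !big_ord_recl/= big1 ?addr0; last by move=> i _; rewrite mulr0.
  have [->|tn0] := eqVneq (t 0%N) 0; first by rewrite mul0r rnorm_ge0.
  have -> : of_real (t 0%N) *: Phi +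
      \sum_(i < N) of_real (t (bump 0 i)) *: - bidual_eval (x i) =
      of_real (t 0%N) *: (Phi - bidual_eval
        (\sum_(i < N) of_real ((t 0%N)^-1 * t (bump 0 i)) *: x i)).
    rewrite scalerBr -bidual_evalZ; congr (_ + _); apply: dual_ext => h.
    rewrite dual_sum dualN bidual_evalE scaler_sumr dual_ap_sum -sumrN.
    apply: eq_bigr => i _; rewrite dualZ dualN bidual_evalE mulrN.
    by rewrite scalerA -of_realM mulVKf// dual_apZ.
  by rewrite rnormZr ger0_norm// ler_wpM2l.
exists f; split=> //; first exact: (fg 0%N).
move=> i iN; have /= := fg i.+1 iN.
by rewrite dualN bidual_evalE scalar_reN sub0r ltrN2 => /ltW.
Qed.

(** Goldstine's density of the ball of [Y] in the ball of the bidual, tested on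
    finitely many functionals. *)
Let next_vector N (f : nat -> dual Y) :
  (forall i, (i <= N)%N -> d - e < scalar_re (Phi (f i))) ->
  exists2 w : Y, rnorm w <= 1 & forall i, (i <= N)%N -> 2 * e <= scalar_re (f i w).
Proof.
move=> fPhi; pose b i := scalar_re (Phi (f i)) / M.
have [|w w1 wb] := @helly R k Y N f b e e0.
  move=> t t0; have -> : \sum_(j < N.+1) t j * b j =
      scalar_re (Phi (\sum_(j < N.+1) of_real (t j) *: f j)) / M.
    rewrite dual_ap_sum scalar_re_sum mulr_suml; apply: eq_bigr => j _.
    by rewrite re_dual_apZ mulrA.
  rewrite ler_pdivrMr// (le_trans (re_dual_le _ _))// mulrC ler_wpM2l ?rnorm_ge0//.
  by rewrite lerDl.
exists w => // i iN; apply/ltW/(le_lt_trans _ (wb i iN)).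
rewrite lerBrDr ler_pdivlMr// (le_trans _ (ltW (fPhi i iN)))//.
have -> : (2 * e + e) * M = 3 * (e * M) by ring.
by rewrite ed; have := e_le; lra.
Qed.

(** James's construction alternates the two steps: each new functional is small
    on the earlier vectors and large at [Phi], and each new vector imitates
    [Phi / M] on all the functionals chosen so far, where [M] exceeds the norm of
    [Phi]. *)
Lemma james_sequence N :
  exists2 x : nat -> Y, (forall i, rnorm (x i) <= 1) & hull_separated N e x.
Proof.
suff [x [f [x1 fP fx1 fx2]]] : exists (x : nat -> Y) (f : nat -> dual Y),
    [/\ forall i, rnorm (x i) <= 1,
        forall i, (i < N)%N -> rnorm (f i) <= 1 /\ d - e < scalar_re (Phi (f i)),
        forall l i, (i < l < N)%N -> scalar_re (f l (x i)) <= e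
      & forall l i, (l <= i < N)%N -> 2 * e <= scalar_re (f l (x i))].
  exists x => //; rewrite (_ : e = 2 * e - e); last by lra.
  by apply: (@separated_by_functionals _ _ _ _ _ _ _ f) => // l /fP[].
elim: N => [|N [x [f [x1 fP fx1 fx2]]]].
  by exists (fun=> 0), (fun=> 0); split=> // [i|l i|l i]; rewrite ?rnorm0 ?ler01 ?ltn0 ?andbF.
have [h [h1 hPhi hx]] := next_functional N x.
pose f' i := if i == N then h else f i.
have f'P i : (i <= N)%N -> rnorm (f' i) <= 1 /\ d - e < scalar_re (Phi (f' i)).
  rewrite leq_eqVlt /f'; case: eqP => //= _; exact: fP.
have [|w w1 wf] := @next_vector N f'; first by move=> i /f'P[].
exists (fun i => if i == N then w else x i), f'; split.
- by move=> i; case: eqP.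
- by move=> i; rewrite ltnS; exact: f'P.
- move=> l i /andP[il]; rewrite ltnS leq_eqVlt => /orP[/eqP lN|lN].
    by rewrite /f' lN eqxx ltn_eqF -?lN// hx// -lN.
  by rewrite /f' !ltn_eqF ?(ltn_trans il)// fx1// il.
- move=> l i /andP[li]; rewrite ltnS leq_eqVlt => /orP[/eqP iN|iN].
    by rewrite iN eqxx; apply: wf; rewrite -iN.
  by rewrite /f' !ltn_eqF ?(leq_ltn_trans li)// fx2// li.
Qed.

End sequence.

Lemma nonreflexive_separated (Y : completeNormedModType K) :
  ~ reflexive_space Y -> exists2 th : R, 0 < th &
    forall N, exists2 x : nat -> Y, (forall i, rnorm (x i) <= 1) & hull_separated N th x.
Proof.
move=> /existsNP[Phi PhiY].
have [|d d0 dPhi] := @bidual_dist Y Phi.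
  by move=> y Phiy; apply: PhiY; exists y => f; rewrite Phiy bidual_evalE.
exists (d / (4 * (rnorm Phi + 1))); last exact: james_sequence.
by rewrite divr_gt0// mulr_gt0// (lt_le_trans ltr01)// lerDr rnorm_ge0.
Qed.

End james.

(** * Weak cluster points and convex hulls *)

Section mazur.
Context {R : realType} {k : scalar_kind}.
Local Notation K := (scalars R k).
Variable V : normedModType K.

Lemma big_nat_zero_tail (W : nmodType) (F : nat -> W) (n m m' : nat) :
  (n <= m <= m')%N -> (forall i, (m <= i)%N -> F i = 0) ->
  \sum_(n <= i < m') F i = \sum_(n <= i < m) F i.
Proof.
move=> /andP[nm mm'] F0; rewrite (big_cat_nat nm mm')/=.
have -> : \sum_(m <= i < m') F i = 0 by rewrite big_nat big1// => i /andP[/F0].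
by rewrite addr0.
Qed.

(** Mazur's theorem. If the hull of a tail stays at distance [e] from [z], then the
    constraints [e <= u (q i - z)] generate a cone that does not exceed the norm.
    A functional that meets them keeps [q i] away from [z], so that [z] is not a
    weak cluster point. *)
Lemma mazur (q : nat -> V) (z : V) :
  (forall (f : dual V) e n, 0 < e ->
     exists2 i, (n <= i)%N & scalar_re (f (q i)) < scalar_re (f z) + e) ->
  forall (n : nat) (e : R), 0 < e -> exists m a,
    [/\ (n <= m)%N, forall i, 0 <= a i, \sum_(n <= i < m) a i = 1
      & rnorm (z - \sum_(n <= i < m) of_real (a i) *: q i) < e].
Proof.
move=> zq n e e0; apply: contrapT => far.
(* Weights are cut off at [m], so that two of them can be added over a common
   range. *)
pose G := [set y : V * R | exists m a, [/\ (n <= m)%N, forall i, 0 <= a i,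
  forall i, (m <= i)%N -> a i = 0,
  y.1 = \sum_(n <= i < m) of_real (a i) *: (q i - z)
  & y.2 = e * \sum_(n <= i < m) a i]].
have cG : constraint_cone G.
  split.
  - exists (0, 0); exists n, (fun=> 0); split=> //=; rewrite big_geq//.
    by rewrite mulr0.
  - move=> _ _ _ _ [m [a [nm a0 am /= -> ->]]] [m' [b [nm' b0 bm /= -> ->]]].
    have le1 : (n <= m <= maxn m m')%N by rewrite nm leq_maxl.
    have le2 : (n <= m' <= maxn m m')%N by rewrite nm' leq_maxr.
    exists (maxn m m'), (fun i => a i + b i); split.
    + by rewrite (leq_trans nm)// leq_maxl.
    + by move=> i; rewrite addr_ge0.
    + by move=> i; rewrite geq_max => /andP[? ?]; rewrite am// bm// addr0.
    + rewrite /= -(big_nat_zero_tail le1) => [|i /am ->]; last by rewrite of_real0 scale0r.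
      rewrite -(big_nat_zero_tail le2) => [|i /bm ->]; last by rewrite of_real0 scale0r.
      by rewrite -big_split; apply: eq_bigr => i _; rewrite of_realD scalerDl.
    + rewrite /= -(big_nat_zero_tail le1)// -(big_nat_zero_tail le2)//.
      by rewrite -mulrDr -big_split.
  - move=> t _ _ t0 [m [a [nm a0 am /= -> ->]]].
    exists m, (fun i => t * a i); split=> //=.
    + by move=> i; rewrite mulr_ge0.
    + by move=> i /am ->; rewrite mulr0.
    + by rewrite scaler_sumr; apply: eq_bigr => i _; rewrite of_realM scalerA.
    + by rewrite -mulr_sumr mulrCA.
have Gle y s : G (y, s) -> s <= 1 * rnorm y.
  move=> [m [a [nm a0 am /= -> ->]]]; rewrite mul1r.
  set t := \sum_(n <= i < m) a i.
  have t0 : 0 <= t by exact: sumr_ge0.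
  have [->|tn0] := eqVneq t 0; first by rewrite mulr0 rnorm_ge0.
  have tp : 0 < t by rewrite lt_neqAle eq_sym tn0.
  rewrite leNgt; apply/negP => lt; apply: far; exists m, (fun i => t^-1 * a i).
  split=> //.
  - by move=> i; rewrite mulr_ge0// invr_ge0.
  - by rewrite -mulr_sumr mulVf.
  have -> : z - \sum_(n <= i < m) of_real (t^-1 * a i) *: q i =
      - (of_real t^-1 *: \sum_(n <= i < m) of_real (a i) *: (q i - z)).
    under [X in _ = - (_ *: X)]eq_bigr do rewrite scalerBr.
    rewrite sumrB scalerBr opprB -scaler_suml scalerA; congr (_ - _).
      rewrite -(big_morph _ (@of_realD R k) (of_real0 R k)) -of_realM mulVf//.
      by rewrite of_real1 scale1r.
    by rewrite scaler_sumr; apply: eq_bigr => i _; rewrite of_realM scalerA.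
  rewrite rnormN rnormZr ger0_norm ?invr_ge0// mulrC.
  by rewrite ltr_pdivrMr.
have [f _ fG] := hahn_banach_dual ler01 cG Gle.
have [i ni] := zq f e n e0; apply/negP; rewrite -leNgt -lerBrDl.
rewrite -scalar_reN -scalar_reD -dual_apB.
(* The constraint given by the single term [q i]. *)
apply: fG; exists i.+1, (fun j => (j == i)%:R); split=> /=.
- by rewrite leqW.
- by move=> j; rewrite ler0n.
- by move=> j ij; rewrite gtn_eqF.
- rewrite big_nat_recr//= eqxx of_real1 scale1r big_nat big1 ?add0r// => j /andP[_ ji].
  by rewrite ltn_eqF// of_real0 scale0r.
- rewrite big_nat_recr//= eqxx big_nat big1 ?add0r ?mulr1// => j /andP[_ ji].
  by rewrite ltn_eqF.
Qed.

(** A first convex combination that comes close to the cluster point uses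
    finitely many terms; a second one, over the later terms only, comes as close, so
    the hulls of these two blocks nearly meet. *)
Lemma not_separated_cluster (q : nat -> V) (z : V) (th : R) : 0 < th ->
  (forall (f : dual V) e n, 0 < e ->
     exists2 i, (n <= i)%N & scalar_re (f (q i)) < scalar_re (f z) + e) ->
  ~ (forall N, hull_separated N th q).
Proof.
move=> th0 zq sq; have th2 : 0 < th / 2 by rewrite divr_gt0.
have [l [a [_ a0 al za]]] := mazur zq 0 th2.
have [m [b [lm b0 bm zb]]] := mazur zq l th2.
pose c i := if (i < l)%N then a i else b i.
have ca : forall (W : nmodType) (F : R -> nat -> W),
    \sum_(0 <= i < l) F (c i) i = \sum_(0 <= i < l) F (a i) i.
  by move=> W F; apply: eq_big_nat => i /= il; rewrite /c il.
have cb : forall (W : nmodType) (F : R -> nat -> W),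
    \sum_(l <= i < m) F (c i) i = \sum_(l <= i < m) F (b i) i.
  by move=> W F; apply: eq_big_nat => i /andP[li _]; rewrite /c ltnNge li.
have := sq m l m c; rewrite lm leqnn => /(_ isT).
rewrite (ca _ (fun r _ => r)) (cb _ (fun r _ => r)).
rewrite (ca _ (fun r i => of_real r *: q i)) (cb _ (fun r i => of_real r *: q i)).
move=> /(_ _ al bm) => H; have /H : forall i, 0 <= c i by move=> i; rewrite /c; case: ifP.
apply/negP; rewrite -ltNge -(subrKA z) (le_lt_trans (ler_rnormD _ _))//.
by rewrite [ltRHS]splitr ltrD// rnormB.
Qed.

End mazur.

(** * Ultrapowers *)

Section ultrapowers.
Context {R : realType} {k : scalar_kind}.
Local Notation K := (scalars R k).

Lemma bounded_set_rnorm (V : normedModType K) (A : set V) :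
  bounded_set A <-> exists B, forall x, A x -> rnorm x <= B.
Proof.
split=> [/pinfty_ex_gt0[M M0 AM]|[B AB]].
  exists (scalar_re M) => x /AM xM.
  by rewrite -(ler_of_real k) of_real_rnorm of_real_scalar_re ?(ltW M0).
exists (of_real B); split.
  by rewrite realE -(of_real0 R k) !ler_of_real -realE num_real.
by move=> M BM x /AB xB; apply: le_trans (ltW BM); rewrite norm_le_rnorm.
Qed.

Lemma free_ultrafilter_tail (U : free_ultrafilter) n :
  fu_sets U [set m | (n <= m)%N].
Proof.
elim: n => [|n IHn]; first by apply: filterS filterT.
have [A [UA An]] : exists A, fu_sets U A /\ ~ A n.
  apply: contrapT => nA; have : set0 n by rewrite -(fu_free U) => A UA; apply: contrapT => An; apply: nA; exists A.
  by [].
apply: filterS (filterI IHn UA) => m [/= nm Am].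
by rewrite ltn_neqAle nm andbT; apply/eqP => nm'; apply: An; rewrite nm'.
Qed.

Lemma exists_free_ultrafilter : exists U : free_ultrafilter, True.
Proof.
have [F [uF subF]] := @ultraFilterLemma nat \oo _.
suff F0 : \bigcap_(A in F) A = set0 by exists (FreeUltrafilter uF F0).
rewrite -subset0 => n Fn; have : [set m | (n < m)%N] n by apply: Fn; apply: subF; exists n.+1.
by rewrite /= ltnn.
Qed.

Variables (Y : normedModType K) (U : free_ultrafilter).

Lemma linfty_of_bounded (u : nat -> Y) B : (forall n, rnorm (u n) <= B) ->
  exists v : linfty Y, val v = u.
Proof.
move=> uB; have bu : u \in @linfty_pred R k Y by apply/asboolP; exists B => n _.
by exists (exist _ u bu).
Qed.

Lemma ultra_class_sum (I : Type) (s : seq I) (a : I -> K) (u : I -> linfty Y) :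
  ultra_class U (\sum_(i <- s) a i *: u i) = \sum_(i <- s) a i *: ultra_class U (u i).
Proof.
elim: s => [|i s IHs]; first by rewrite !big_nil ultra_class0.
by rewrite !big_cons ultra_classD IHs ultra_classZ.
Qed.

(** Two representatives of a class differ by a null sequence along [U], so every
    representative has terms of norm at least [c - e]. *)
Lemma rnorm_ultra_class_ge (u : linfty Y) (c : R) :
  fu_sets U [set n | c <= rnorm (val u n)] -> c <= rnorm (ultra_class U u).
Proof.
move=> Uc; rewrite /rnorm /Num.norm/= of_realK; apply: lb_le_inf.
  by exists (rnorm u); exists u.
move=> _ [v /ultra_class_eq /asboolP uv <-]; apply/ler_addgt0Pl => e e0.
have /cvgrPdist_le /(_ _ e0) Ue := uv.
have [n [cn en]] := filter_ex (filterI Uc Ue).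
have : rnorm (val v n - val u n) <= e.
  by move: en; rewrite /= sub0r normrN ger0_norm ?rnorm_ge0// raddfB.
rewrite rnormB => vun; rewrite (le_trans cn)// -[val u n](subrK (val v n)).
rewrite (le_trans (ler_rnormD _ _))// lerD//.
by rewrite rnorm_linfty; apply: sup_norm_ub => //; exact: linftyP.
Qed.

End ultrapowers.

Section super_weak_compactness.
Context {R : realType} {k : scalar_kind}.
Local Notation K := (scalars R k).

(** All that the later arguments use of the weak topology: along the sequence the
    real part of every functional falls, infinitely often, below any number
    greater than its value at [z]. *)
Lemma weak_cluster (V : normedModType K) (A : set V) (q : nat -> V) :
  relatively_weakly_compact A -> (forall i, A (q i)) ->
  exists z : V, forall (f : dual V) e n, 0 < e ->
    exists2 i, (n <= i)%N & scalar_re (f (q i)) < scalar_re (f z) + e.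
Proof.
move=> cA Aq; pose F : set_system (weakly V) := (q : nat -> weakly V) @ \oo.
have FA : F (closure (A : set (weakly V))).
  by exists 0%N => // i _; apply: subset_closure; exact: Aq.
have [z [_ Fz]] := cA F (fmap_proper_filter _ _) FA.
exists z => f e n e0.
have fz : nbhs (z : weakly V) [set w | scalar_re (f w) < scalar_re (f z) + e].
  have zf : nbhs (z : initial_topology (dual_fun f))
      [set w | scalar_re (f w) < scalar_re (f z) + e].
    have eK : 0 < of_real e :> K by rewrite -(of_real0 R k) ltr_of_real.
    have := @initial_continuous _ _ (dual_fun f) z.
    move=> /cvgrPdist_lt /(_ _ eK); apply: filterS => w /=.
    rewrite -of_real_rnorm ltr_of_real rnormB => wz.
    rewrite -ltrBlDl (le_lt_trans _ wz)// -scalar_reN -scalar_reD.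
    exact: scalar_re_le_norm.
  have /cvg_sup zz : nbhs (z : weakly V) --> (z : weakly V) by [].
  exact: (zz f _ zf).
have Fq : F [set w | exists2 i, (n <= i)%N & q i = w].
  by exists n => // i /= ni; exists i.
by have [_ [[i ni <-] fi]] := Fz _ _ Fq fz; exists i.
Qed.

(** Finite separated sequences, one for each length, assemble into a single infinite
    one: the classes of their [i]-th terms, in the ultrapower. It is separated
    because almost all indices exceed any given [N], and a weak cluster point of
    it cannot exist. *)
Lemma not_hull_separated_of_super_weakly_compact (V : normedModType K)
    (A : set V) (th : R) :
  bounded_set A -> relatively_super_weakly_compact A -> 0 < th ->
  ~ (forall N, exists2 x : nat -> V, (forall i, A (x i)) & hull_separated N th x).
Proof.
move=> /bounded_set_rnorm[B AB] cA th0.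
move=> /(_ _)/cid2-/all_sig2[x Ax sx].
have [U _] := exists_free_ultrafilter.
have /choice[u uE] i : exists u : linfty V, val u = fun n => x n i.
  by apply: (@linfty_of_bounded _ _ _ _ B) => n; exact: AB.
pose q i := ultra_class U (u i).
have Aq i : @ultra_set R k V U A (q i) by exists (u i) => // n; rewrite uE.
have [z zq] := weak_cluster (cA U) Aq.
apply: not_separated_cluster th0 zq _ => N l m a lmN a0 al am.
rewrite -!ultra_class_sum -[X in _ - X]scale1r -scaleNr.
rewrite -[_ *: ultra_class U _]ultra_classZ scaleN1r -ultra_classD.
apply: rnorm_ultra_class_ge.
apply: filterS (free_ultrafilter_tail U N) => n /= Nn.
have vsum n1 n2 : val (\sum_(n1 <= i < n2) of_real (a i) *: u i) n =
    \sum_(n1 <= i < n2) of_real (a i) *: x n i.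
  have -> : val (\sum_(n1 <= i < n2) of_real (a i) *: u i) =
     \sum_(n1 <= i < n2) of_real (a i) *: (val (u i) : nat -> V).
    by rewrite raddf_sum; apply: eq_bigr => i _; exact: linearZ.
  rewrite fct_sumE; apply: eq_bigr => i _; by rewrite uE.
rewrite -[X in rnorm X]/(\val (\sum_(0 <= i < l) of_real (a i) *: u i) n -
  \val (\sum_(l <= i < m) of_real (a i) *: u i) n) !vsum.
by apply: sx => //; case/andP: lmN => -> /leq_trans; apply.
Qed.

End super_weak_compactness.

(** * Copies of [l_1^N] and type *)

Section l1_bases.
Context {R : realType} {k : scalar_kind}.
Local Notation K := (scalars R k).

Lemma hull_separatedW (V : normedModType K) (N N' : nat) (th : R) (x : nat -> V) :
  (N <= N')%N -> hull_separated N' th x -> hull_separated N th x.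
Proof.
move=> NN' sx l m a /andP[lm mN]; apply: sx; rewrite lm/=.
exact: leq_trans NN'.
Qed.

(** The difference of two convex combinations over disjoint blocks has
    coefficients of total modulus two. *)
Lemma hull_separated_l1N (V : normedModType K) (N : nat) (C : R) (x : nat -> V) :
  0 < C -> equiv_l1N C (fun i : 'I_N => x i) -> hull_separated N C^-1 x.
Proof.
move=> C0 l1x l m a /andP[lm mN] a0 al am.
pose c i : R := if (i < l)%N then a i else if (i < m)%N then - a i else 0.
have split3 (W : nmodType) (F : nat -> W) : \sum_(0 <= i < N) F i =
    \sum_(0 <= i < l) F i + \sum_(l <= i < m) F i + \sum_(m <= i < N) F i.
  by rewrite (big_cat_nat _ (leq_trans lm mN))//= (big_cat_nat lm mN)/= addrA.
have c1 i : (0 <= i < l)%N -> c i = a i by move=> /= il; rewrite /c il.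
have c2 i : (l <= i < m)%N -> c i = - a i.
  by move=> /andP[li im]; rewrite /c ltnNge li im.
have c3 i : (m <= i < N)%N -> c i = 0.
  by move=> /andP[mi _]; rewrite /c !ltnNge (leq_trans lm mi) mi.
have [+ _] := l1x (fun i => of_real (c i)).
under eq_bigr do rewrite scalar_re_norm_of_real.
rewrite -(big_mkord xpredT (fun i => `|c i|)).
rewrite -(big_mkord xpredT (fun i => of_real (c i) *: x i)) !split3.
rewrite (eq_big_nat _ _ (fun i ii => congr1 Num.norm (c1 i ii))).
rewrite (eq_big_nat _ _ (fun i ii => congr1 Num.norm (c2 i ii))).
rewrite (eq_big_nat _ _ (fun i ii => congr1 Num.norm (c3 i ii))).
rewrite (eq_big_nat _ _ (fun i ii => congr1 (fun t => of_real t *: x i) (c1 i ii))).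
rewrite (eq_big_nat _ _ (fun i ii => congr1 (fun t => of_real t *: x i) (c2 i ii))).
rewrite (eq_big_nat _ _ (fun i ii => congr1 (fun t => of_real t *: x i) (c3 i ii))).
under eq_bigr do rewrite ger0_norm//.
under [X in _ + X + _]eq_bigr do rewrite normrN ger0_norm//.
rewrite al am big1 ?addr0; last by move=> i _; rewrite normr0.
under [X in _ + X + _]eq_bigr do rewrite of_realN scaleNr.
rewrite [X in _ + X + _]sumrN [X in _ - _ + X]big1 ?addr0; last first.
  by move=> i _; rewrite of_real0 scale0r.
by apply: le_trans; rewrite ler_peMr ?invr_ge0 ?(ltW C0)// lerDl.
Qed.

Lemma contains_l1N_hull_separated (V : normedModType K) (A : set V) :
  contains_l1N_uniformly A -> exists2 th : R, 0 < th &
    forall N, exists2 x : nat -> V, (forall i, A (x i)) & hull_separated N th x.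
Proof.
move=> [C C0 AC]; exists C^-1; first by rewrite invr_gt0.
(* One vector too many, so that [inord] provides all later terms, inside [A]. *)
move=> N; have [x Ax l1x] := AC N.+1.
exists (fun i => x (inord i)) => //; apply: (hull_separatedW (leqnSn N)).
apply: hull_separated_l1N => //; rewrite (_ : (fun _ => _) = x)//.
by apply/funext => i; rewrite inord_val.
Qed.

Lemma contains_l1_basis_l1N (V : normedModType K) (A : set V) :
  contains_l1_basis A -> contains_l1N_uniformly A.
Proof.
by move=> [x Ax [C C0 xC]]; exists C => // N; exists (fun i : 'I_N => x i).
Qed.

(** In the sign averages of [n] vectors spanning a copy of [l_1^n] every term is
    at least [n / C], whereas type [p] bounds the average by a multiple of
    [n `^ p^-1], which is smaller for large [n]. *)
Lemma type_not_l1N (V : normedModType K) (p : R) (A : set V) : 1 < p ->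
  has_type p V -> bounded_set A -> ~ contains_l1N_uniformly A.
Proof.
move=> p1 [T T0 tp] /bounded_set_rnorm[B AB] [C C0 AC].
have p0 : 0 < p by rewrite (lt_trans ltr01).
have pn0 : p != 0 by rewrite gt_eqF.
pose B' := Num.max B 1.
have B0 : 0 < B' by rewrite lt_max ltr01 orbT.
have key n : (0 < n)%N -> n%:R / C <= T * B' * n%:R `^ p^-1.
  move=> n0; have [x Ax l1x] := AC n.
  have nC0 : 0 <= n%:R / C by rewrite divr_ge0// ltW.
  have powK (r : R) : 0 <= r -> (r `^ p) `^ p^-1 = r.
    by move=> r0; rewrite -powRrM mulfV// powRr1.
  apply: le_trans (_ : T * (\sum_(i < n) rnorm (x i) `^ p) `^ p^-1 <= _); last first.
    rewrite -mulrA ler_wpM2l ?(ltW T0)//.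
    rewrite -[X in X * _]powK ?(ltW B0)// -powRM ?powR_ge0//.
    rewrite ge0_ler_powR ?invr_ge0 ?(ltW p0) ?nnegrE//.
    - by apply: sumr_ge0 => i _; rewrite powR_ge0.
    - by rewrite mulr_ge0 ?powR_ge0.
    rewrite mulrC mulr_natl -[n in _ *+ n]card_ord -sumr_const.
    apply: ler_sum => i _; rewrite ge0_ler_powR ?(ltW p0) ?nnegrE ?rnorm_ge0 ?(ltW B0)//.
    by rewrite le_max AB.
  apply: le_trans (tp n x); rewrite -{1}[n%:R / C]powK//.
  rewrite ge0_ler_powR ?invr_ge0 ?(ltW p0) ?nnegrE ?powR_ge0//.
    rewrite mulr_ge0 ?invr_ge0 ?exprn_ge0//.
    by apply: sumr_ge0 => e _; rewrite powR_ge0.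
  rewrite ler_pdivlMl ?exprn_gt0//.
  have -> : 2 ^+ n = #|{: {ffun 'I_n -> bool}}|%:R :> R.
    by rewrite card_ffun card_bool card_ord natrX.
  rewrite [leLHS]mulr_natl -sumr_const; apply: ler_sum => e _.
  rewrite ge0_ler_powR ?(ltW p0) ?nnegrE ?rnorm_ge0//.
  have [+ _] := l1x (fun i => (-1) ^+ e i).
  under eq_bigr do rewrite normrX normrN1 expr1n -(normr1 K) scalar_re_norm1.
  by rewrite sumr_const card_ord mulrC.
pose s := 1 - p^-1.
have s0 : 0 < s by rewrite subr_gt0 invf_lt1.
pose D := T * B' * C.
have D0 : 0 < D by rewrite !mulr_gt0.
(* Chosen so that [n `^ (1 - p^-1)] exceeds the product of the constants. *)
pose n := (Num.truncn (D `^ s^-1)).+1.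
have nD : D `^ s^-1 < n%:R by rewrite truncnS_gt.
have nr0 : 0 < n%:R :> R by rewrite ltr0n.
have := key n isT; rewrite ler_pdivrMr// mulrAC -/D.
have nE : n%:R = n%:R `^ s * n%:R `^ p^-1 :> R.
  by rewrite -powRD ?subrK ?powRr1 ?ler0n// oner_eq0.
rewrite [leLHS]nE ler_pM2r ?powR_gt0// leNgt => /negP; apply.
have := @gt0_ltr_powR _ _ s0 _ _ _ _ nD.
rewrite !nnegrE powR_ge0 ler0n => /(_ isT isT).
by rewrite -powRrM mulVf ?gt_eqF// powRr1// ltW.
Qed.

End l1_bases.

(** * Finite representability *)

Section family_span.
Context {R : realType} {k : scalar_kind}.
Local Notation K := (scalars R k).
Variables (Y : normedModType K) (n : nat) (x : 'I_n -> Y).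

Definition family_span_pred : {pred Y} :=
  fun y => `[< exists a : 'I_n -> K, y = \sum_i a i *: x i >].

Lemma family_span_closed : submod_closed family_span_pred.
Proof.
split=> [|c u v /asboolP[a ->] /asboolP[b ->]]; apply/asboolP.
  by exists (fun=> 0); rewrite big1// => i _; rewrite scale0r.
exists (fun i => c * a i + b i); rewrite scaler_sumr -big_split.
by apply: eq_bigr => i _; rewrite scalerDl scalerA.
Qed.

HB.instance Definition _ :=
  GRing.isSubmodClosed.Build K Y family_span_pred family_span_closed.

Definition family_span : submodClosed Y := family_span_pred.

Lemma finite_dimensional_family_span : finite_dimensional family_span.
Proof. by exists n, x => y; split=> [/asboolP|?]; last exact/asboolP. Qed.

Lemma mem_family_span i : x i \in family_span.
Proof.
apply/asboolP; exists (fun j => (j == i)%:R); rewrite (bigD1 i)//= eqxx scale1r.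
by rewrite big1 ?addr0// => j /negPf ->; rewrite scale0r.
Qed.

End family_span.

Section finite_representability.
Context {R : realType} {k : scalar_kind}.
Local Notation K := (scalars R k).

(** A map of distortion between [1 / 2] and [3 / 2] on the span of the sequence
    carries it along, at the cost of a factor two in both constants. *)
Lemma hull_separated_finitely_representable (Y Z : normedModType K) (N : nat)
    (th : R) (x : nat -> Y) :
  finitely_representable Y Z -> (forall i, rnorm (x i) <= 1) ->
  hull_separated N th x ->
  exists2 z : nat -> Z, (forall i, rnorm (z i) <= 2) & hull_separated N (th / 2) z.
Proof.
move=> YZ x1 sx; pose E := family_span (fun i : 'I_N => x i).
have e0 : 0 < 2^-1 :> R by rewrite invr_gt0.
have [T TE] := YZ E _ (finite_dimensional_family_span _) e0.
(* The terms beyond [N], which may lie outside the span, become zero. *)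
pose xE i : subspace_of E := insubd 0 (x i).
have xEN i : (i < N)%N -> val (xE i) = x i.
  by move=> iN; rewrite val_insubd (mem_family_span (fun i : 'I_N => x i) (Ordinal iN)).
have xE1 i : rnorm (val (xE i)) <= 1.
  by rewrite val_insubd; case: ifP => // _; rewrite raddf0 rnorm0 ler01.
exists (fun i => T (xE i)) => [i|l m a /andP[lm mN] a0 al am].
  have [_ ] := TE (xE i); have := xE1 i; rewrite -[rnorm (val _)]/(rnorm (xE i)).
  by lra.
have Tsum n1 n2 : \sum_(n1 <= i < n2) of_real (a i) *: T (xE i) =
    T (\sum_(n1 <= i < n2) of_real (a i) *: xE i).
  by rewrite linear_sum; apply: eq_bigr => i _; rewrite linearZ.
have vsum n1 n2 : (n2 <= N)%N ->
    val (\sum_(n1 <= i < n2) of_real (a i) *: xE i) =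
    \sum_(n1 <= i < n2) of_real (a i) *: x i.
  move=> n2N; rewrite raddf_sum; apply: eq_big_nat => i /andP[_ ii].
  by rewrite -(xEN i)// (leq_trans ii).
rewrite !Tsum -linearB; set w := _ - _.
have wE : val w = \sum_(0 <= i < l) of_real (a i) *: x i -
                  \sum_(l <= i < m) of_real (a i) *: x i.
  by rewrite raddfB -[LHS]/(val _ - val _) !vsum// (leq_trans lm).
have := sx l m a; rewrite lm mN => /(_ isT a0 al am); rewrite -wE => thw.
have [+ _] := TE w; rewrite -[rnorm w]/(rnorm (val w)).
by lra.
Qed.

End finite_representability.

(** * Banach spaces with property (R) *)

Theorem proposition2p4 (R : realType) (k : scalar_kind)
    (X : completeNormedModType (scalars R k)) (hX : property_R X) :
  (forall A : set X, bounded_set A ->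
     (contains_l1N_uniformly A <-> contains_l1_basis A)) /\
  (forall Z : submodClosed X, closed [set x : X | x \in Z] ->
     nontrivial_type (subspace_of Z) -> superreflexive (subspace_of Z)).
Proof.
split=> [A bA|Z _ [p /andP[p1 _] tp] Y YZ].
  split=> [/contains_l1N_hull_separated[th th0 sA]|]; last first.
    exact: contains_l1_basis_l1N.
  apply: contrapT => nl1.
  exact: not_hull_separated_of_super_weakly_compact bA (hX A (conj bA nl1)) th0 sA.
apply: contrapT => /nonreflexive_separated[th th0 sY].
(* Radius two leaves room for the distortion of the finite representation. *)
pose A := [set x : X | x \in Z /\ rnorm x <= 2].
have bA : bounded_set A by apply/bounded_set_rnorm; exists 2 => x [].
have nl1 : ~ contains_l1_basis A.
  move=> [x Ax l1x].
  pose xZ i : subspace_of Z := exist _ (x i) (Ax i).1.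
  pose B := [set z : subspace_of Z | rnorm z <= 2].
  apply: (@type_not_l1N _ _ _ p B p1 tp).
    by apply/bounded_set_rnorm; exists 2.
  apply: contains_l1_basis_l1N; exists xZ; first by move=> i; exact: (Ax i).2.
  have [C C0 xC] := l1x; exists C => // N a.
  have -> : rnorm (\sum_(i < N) a i *: xZ i) = rnorm (\sum_(i < N) a i *: x i).
    rewrite -[LHS]/(rnorm (val _)) raddf_sum; congr rnorm; exact: eq_bigr.
  exact: xC.
have th2 : 0 < th / 2 by rewrite divr_gt0.
apply: not_hull_separated_of_super_weakly_compact bA (hX A (conj bA nl1)) th2 _ => // N.
have [x x1 sx] := sY N.
have [z z2 sz] := hull_separated_finitely_representable YZ x1 sx.
exists (fun i => val (z i)) => [i|l m a lmN a0 al am].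
  by split; [exact: valP|exact: z2].
have := sz l m a lmN a0 al am; rewrite -[rnorm _]/(rnorm (val _)).
by rewrite raddfB !raddf_sum.
Qed.
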